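(* Let $M$ be a smooth manifold of dimension $2n+1$, $n\geq1$, let $\eta$ be a contact form on $M$ and let $(\pi,\xi)$ be the Jacobi structure associated with $\eta$. Then the skew algebroid $(T^*M,\sharp_{\pi,\xi},[\cdot,\cdot]_{\pi,\xi}^{\eta})$ is a Lie algebroid isomorphic to the tangent algebroid $(TM,\mathrm{id},[\cdot,\cdot])$ of $M$.
   Context: A contact form is a $1$-form $\eta$ such that $\eta\wedge(d\eta)^{n}$ is a volume form. Its associated Jacobi structure $(\pi,\xi)$ is given by $\pi(\alpha,\beta)=d\eta(\sharp_\eta(\alpha),\sharp_\eta(\beta))$ and $\xi=\sharp_\eta(\eta)$, where $\sharp_\eta$ is the inverse of the bundle isomorphism $\flat_\eta:TM\to T^*M$, $\flat_\eta(X)=-i_Xd\eta+\eta(X)\eta$. Then $\xi$ is the Reeb field ($i_\xi d\eta=0$, $\eta(\xi)=1$). Here $d\eta(X,Y)=X(\eta(Y))-Y(\eta(X))-\eta([X,Y])$. (Jacobi structure means: $[\pi,\pi]=2\xi\wedge\pi$ and $\mathcal{L}_\xi\pi=0$, for the Schouten-Nijenhuis bracket.) A skew algebroid over $M$ is a triple $(E,\sharp_E,[\cdot,\cdot]_E)$ with $E\to M$ a vector bundle, $\sharp_E:E\to TM$ a vector bundle morphism (the anchor), and $[\cdot,\cdot]_E$ an alternating $\mathbb{R}$-bilinear bracket on $\Gamma(E)$ with $[s,\varphi t]_E=\varphi[s,t]_E+\sharp_E(s)(\varphi)\,t$ for $\varphi\in C^\infty(M)$. It is a Lie algebroid if $[\cdot,\cdot]_E$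 satisfies the Jacobi identity. Define $\sharp_\pi:T^*M\to TM$ by $\beta(\sharp_\pi(\alpha))=\pi(\alpha,\beta)$, $[\alpha,\beta]_\pi=\mathcal{L}_{\sharp_\pi(\alpha)}\beta-\mathcal{L}_{\sharp_\pi(\beta)}\alpha-d(\pi(\alpha,\beta))$, $\sharp_{\pi,\xi}(\alpha)=\sharp_\pi(\alpha)+\alpha(\xi)\xi$, and, for $\lambda\in\Omega^1(M)$, $$[\alpha,\beta]_{\pi,\xi}^{\lambda}=[\alpha,\beta]_\pi+\alpha(\xi)(\mathcal{L}_\xi\beta-\beta)-\beta(\xi)(\mathcal{L}_\xi\alpha-\alpha)-\pi(\alpha,\beta)\lambda.$$ The triple $(T^*M,\sharp_{\pi,\xi},[\cdot,\cdot]_{\pi,\xi}^{\lambda})$ is a skew algebroid. *)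

(* Defs.v *)
From mathcomp Require Import all_boot all_order all_fingroup all_algebra.
From mathcomp Require Import all_classical all_reals all_analysis.
Set Implicit Arguments.
Unset Strict Implicit.
Unset Printing Implicit Defensive.
Import Order.TTheory GRing.Theory Num.Theory.
Import numFieldNormedType.Exports.
Local Open Scope classical_set_scope.
Local Open Scope ring_scope.

Section SmoothMaps.
Variables (R : realType) (V W : normedModType R).

Fixpoint Ck (k : nat) (U : set V) (f : V -> W) : Prop :=
  if k is k'.+1 then
    (forall x, U x -> differentiable f x) /\
    (forall v, Ck k' U (fun x => 'D_v f x))
  else forall x, U x -> {for x, continuous f}.

Definition smooth (U : set V) (f : V -> W) : Prop := forall k, Ck k U f.

End SmoothMaps.

(** A smooth manifold of dimension m, given by a smooth atlas.  [chart c] and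
    [chart_inv c] are only meaningful on [dom c] and on its image.
    [chart_at p] is a chart around p, fixed once and for all: it is used to
    name the vectors of the fibres over p (see [bundle_data]). *)
Record manifold (R : realType) (m : nat) := Manifold {
  points :> topologicalType;
  chart_ix : Type;
  dom : chart_ix -> set points;
  chart : chart_ix -> points -> 'rV[R]_m;
  chart_inv : chart_ix -> 'rV[R]_m -> points;
  chart_at : points -> chart_ix;
  points_hausdorff : hausdorff_space points;
  points_second_countable : @second_countable points;
  dom_open : forall c, open (dom c);
  cod_open : forall c, open (chart c @` dom c);
  chartK : forall c p, dom c p -> chart_inv c (chart c p) = p;
  chart_continuous : forall c p, dom c p -> {for p, continuous (chart c)};
  chart_inv_continuous : forall c x, (chart c @` dom c) x ->
    {for x, continuous (chart_inv c)};
  transition_smooth : forall c c',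
    smooth (chart c @` (dom c `&` dom c')) (chart c' \o chart_inv c);
  dom_chart_at : forall p, dom (chart_at p) p
}.

Section Manifold.
Variables (R : realType) (m : nat) (M : manifold R m).

Definition smooth_on (W : normedModType R) (U : set M) (f : M -> W) : Prop :=
  forall c : chart_ix M,
    smooth (chart c @` (dom c `&` U)) (f \o chart_inv c).

Definition smooth_fun (W : normedModType R) (f : M -> W) : Prop :=
  smooth_on setT f.

(** A vector bundle of rank r over M given by its transition functions.  The
    total space is the disjoint union of the [triv_dom a] * R^r modulo
      (a, p, e) ~ (b, p, e *m cocycle a b p);
    the class of (a, p, e) is the vector over p whose expression in the
    trivialization a is e.  Each vector over p has a unique representative
    (triv_at p, p, e), so that the fibre over p is identified with 'rV_r:
    a section is a map M -> 'rV_r and a bundle morphism over the identity of M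
    is a map M -> 'M_(r, r') (acting on row vectors). *)
Record bundle_data (r : nat) := BundleData {
  triv_ix : Type;
  triv_dom : triv_ix -> set M;
  triv_at : M -> triv_ix;
  cocycle : triv_ix -> triv_ix -> M -> 'M[R]_r
}.

Definition vector_bundle (r : nat) (E : bundle_data r) : Prop :=
  [/\ forall a : triv_ix E, open (triv_dom a),
      forall p, triv_dom (triv_at E p) p,
      forall a b : triv_ix E,
        smooth_on (triv_dom a `&` triv_dom b) (cocycle a b),
      forall (a : triv_ix E) p, triv_dom a p -> cocycle a a p = 1%:M
    & forall (a b c : triv_ix E) p,
        triv_dom a p -> triv_dom b p -> triv_dom c p ->
        cocycle a b p *m cocycle b c p = cocycle a c p].

Definition section (r : nat) (E : bundle_data r) : Type := M -> 'rV[R]_r.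

(** The expression of a section in the trivialization a. *)
Definition local_rep (r : nat) (E : bundle_data r) (s : section E)
    (a : triv_ix E) : M -> 'rV[R]_r :=
  fun p => s p *m cocycle (triv_at E p) a p.

Definition smooth_section (r : nat) (E : bundle_data r) (s : section E) :
    Prop :=
  forall a : triv_ix E, smooth_on (triv_dom a) (local_rep s a).

Definition bundle_map (r r' : nat) (E : bundle_data r) (F : bundle_data r') :
  Type := M -> 'M[R]_(r, r').

Definition smooth_bundle_map (r r' : nat) (E : bundle_data r)
    (F : bundle_data r') (h : bundle_map E F) : Prop :=
  forall (a : triv_ix E) (b : triv_ix F),
    smooth_on (triv_dom a `&` triv_dom b)
      (fun p => cocycle a (triv_at E p) p *m h p *m cocycle (triv_at F p) b p).

Definition map_section (r r' : nat) (E : bundle_data r) (F : bundle_data r')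
    (h : bundle_map E F) (s : section E) : section F :=
  fun p => s p *m h p.

Definition dual_bundle (r : nat) (E : bundle_data r) : bundle_data r :=
  @BundleData r (triv_ix E) (@triv_dom r E) (triv_at E)
    (fun a b p => (cocycle b a p)^T).

Definition TM : bundle_data m :=
  @BundleData m (chart_ix M) (@dom R m M) (@chart_at R m M)
    (fun c c' p => jacobian (chart c' \o chart_inv c) (chart c p)).

Definition T'M : bundle_data m := dual_bundle TM.

Notation vector_field := (section TM).
Notation one_form := (section T'M).

Definition ev (a v : 'rV[R]_m) : R := \sum_(k < m) a 0 k * v 0 k.

(** The covector (resp. the vector) over a point that represents a linear
    functional on the tangent (resp. cotangent) space. *)
Definition represent (phi : 'rV[R]_m -> R) : 'rV[R]_m :=
  \row_k phi (delta_mx 0 k).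

Definition eval_form (alpha : one_form) (X : vector_field) : M -> R :=
  fun p => ev (alpha p) (X p).

Definition dir_deriv (X : vector_field) (f : M -> R) : M -> R :=
  fun p => let c := chart_at p in
    'D_(X p) (f \o chart_inv c) (chart c p).

Definition lie_bracket (X Y : vector_field) : vector_field :=
  fun p => let c := chart_at p in
    'D_(X p) (local_rep (E := TM) Y c \o chart_inv c) (chart c p)
    - 'D_(Y p) (local_rep (E := TM) X c \o chart_inv c) (chart c p).

(** The extension of the tangent vector v over p to the vector field near p
    that has constant components in the chart at p.  Tensorial expressions at p
    are evaluated on such extensions. *)
Definition extend (p : M) (v : 'rV[R]_m) : vector_field :=
  fun q => v *m cocycle (b := TM) (chart_at p) (chart_at q) q.

(** d eta (X, Y) = X(eta(Y)) - Y(eta(X)) - eta([X, Y]). *)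
Definition ext_deriv_fields (eta : one_form) (X Y : vector_field) : M -> R :=
  fun p => dir_deriv X (eval_form eta Y) p - dir_deriv Y (eval_form eta X) p
           - eval_form eta (lie_bracket X Y) p.

Definition ext_deriv (eta : one_form) (p : M) (u v : 'rV[R]_m) : R :=
  ext_deriv_fields eta (extend p u) (extend p v) p.

Definition differential (f : M -> R) : one_form :=
  fun p => represent (fun v => dir_deriv (extend p v) f p).

(** (L_X beta)(Y) = X(beta(Y)) - beta([X, Y]). *)
Definition lie_deriv (X : vector_field) (beta : one_form) : one_form :=
  fun p => represent (fun v =>
    dir_deriv X (eval_form beta (extend p v)) p
    - eval_form beta (lie_bracket X (extend p v)) p).

Definition kform (k : nat) : Type := ('I_k -> 'rV[R]_m) -> R.

Definition wedge (k l : nat) (a : kform k) (b : kform l) : kform (k + l) :=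
  fun v => (k`!%:R * l`!%:R)^-1 *
    \sum_(s : 'S_(k + l)) (-1) ^+ s
      * a (fun i => v (s (lshift l i))) * b (fun j => v (s (rshift k j))).

Fixpoint wedge_pow (w : kform 2) (n : nat) : kform (n * 2) :=
  if n is n'.+1 then wedge w (@wedge_pow w n') else fun=> 1.

Definition contact_volume (n : nat) (eta : one_form) (p : M) :
    kform (1 + n * 2) :=
  wedge (k := 1) (fun v => ev (eta p) (v ord0))
    (@wedge_pow (fun v => ext_deriv eta p (v ord0) (v ord_max)) n).

(** To be used for manifolds of dimension 2n+1, where [contact_volume] is of
    top degree, hence a volume form if and only if it vanishes nowhere. *)
Definition contact_form (n : nat) (eta : one_form) : Prop :=
  smooth_section eta /\ forall p, exists v, @contact_volume n eta p v <> 0.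

Definition flat (eta : one_form) : bundle_map TM T'M :=
  fun p => lin1_mx (fun u => represent (fun v =>
    - ext_deriv eta p u v + ev (eta p) u * ev (eta p) v)).

Definition sharp (eta : one_form) : bundle_map T'M TM :=
  fun p => invmx (flat eta p).

(** Bivector fields, as bilinear forms on the cotangent spaces. *)
Definition bivector : Type := M -> 'rV[R]_m -> 'rV[R]_m -> R.

Definition contact_pi (eta : one_form) : bivector :=
  fun p a b => ext_deriv eta p (a *m sharp eta p) (b *m sharp eta p).

Definition contact_xi (eta : one_form) : vector_field :=
  map_section (sharp eta) eta.

Record algebroid_data (r : nat) := AlgebroidData {
  bundle : bundle_data r;
  anchor : bundle_map bundle TM;
  bracket : section bundle -> section bundle -> section bundle
}.

Record skew_algebroid (r : nat) (A : algebroid_data r) : Prop :=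
  SkewAlgebroid {
  skew_bundle : vector_bundle (bundle A);
  skew_anchor : smooth_bundle_map (anchor A);
  skew_smooth : forall s t : section (bundle A),
    smooth_section s -> smooth_section t -> smooth_section (bracket s t);
  skew_alternating : forall s : section (bundle A),
    smooth_section s -> forall p, bracket s s p = 0;
  skew_linearl : forall (k : R) (s s' t : section (bundle A)),
    smooth_section s -> smooth_section s' -> smooth_section t ->
    forall p, bracket (fun q => k *: s q + s' q) t p
              = k *: bracket s t p + bracket s' t p;
  skew_linearr : forall (k : R) (s t t' : section (bundle A)),
    smooth_section s -> smooth_section t -> smooth_section t' ->
    forall p, bracket s (fun q => k *: t q + t' q) p
              = k *: bracket s t p + bracket s t' p;
  skew_leibniz : forall (phi : M -> R) (s t : section (bundle A)),
    smooth_fun phi -> smooth_section s -> smooth_section t ->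
    forall p, bracket s (fun q => phi q *: t q) p
              = phi p *: bracket s t p
                + dir_deriv (map_section (anchor A) s) phi p *: t p
}.

Definition lie_algebroid (r : nat) (A : algebroid_data r) : Prop :=
  skew_algebroid A /\
  forall s t u : section (bundle A),
    smooth_section s -> smooth_section t -> smooth_section u ->
    forall p, bracket s (bracket t u) p + bracket t (bracket u s) p
              + bracket u (bracket s t) p = 0.

(** Isomorphisms cover the identity of M. *)
Definition algebroid_isomorphic (r r' : nat) (A : algebroid_data r)
    (B : algebroid_data r') : Prop :=
  exists (h : bundle_map (bundle A) (bundle B))
         (h' : bundle_map (bundle B) (bundle A)),
  [/\ smooth_bundle_map h /\ smooth_bundle_map h',
      forall p, h p *m h' p = 1%:M,
      forall p, h' p *m h p = 1%:M,
      forall p, h p *m anchor B p = anchor A p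
    & forall s t : section (bundle A), smooth_section s -> smooth_section t ->
        forall p, map_section h (bracket s t) p
                  = bracket (map_section h s) (map_section h t) p].

Definition tangent_algebroid : algebroid_data m :=
  @AlgebroidData m TM (fun=> 1%:M) lie_bracket.

Section PiXi.
Variables (pi : bivector) (xi : vector_field).

Definition eval_pi (alpha beta : one_form) : M -> R :=
  fun p => pi p (alpha p) (beta p).

Definition sharp_pi : bundle_map T'M TM :=
  fun p => lin1_mx (fun a => represent (pi p a)).

Definition bracket_pi (alpha beta : one_form) : one_form :=
  fun p => lie_deriv (map_section sharp_pi alpha) beta p
           - lie_deriv (map_section sharp_pi beta) alpha p
           - differential (eval_pi alpha beta) p.

Definition sharp_pi_xi : bundle_map T'M TM :=
  fun p => lin1_mx (fun a => a *m sharp_pi p + ev a (xi p) *: xi p).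

Definition bracket_pi_xi (lambda alpha beta : one_form) : one_form :=
  fun p => bracket_pi alpha beta p
           + eval_form alpha xi p *: (lie_deriv xi beta p - beta p)
           - eval_form beta xi p *: (lie_deriv xi alpha p - alpha p)
           - eval_pi alpha beta p *: lambda p.

Definition pi_xi_algebroid (lambda : one_form) : algebroid_data m :=
  @AlgebroidData m T'M sharp_pi_xi (bracket_pi_xi lambda).

End PiXi.

End Manifold.

Notation vector_field M := (section (TM M)).
Notation one_form M := (section (T'M M)).

(* Main.v *)
From mathcomp Require Import all_boot all_order all_fingroup all_algebra.
From mathcomp Require Import all_classical all_reals all_analysis.
From mathcomp Require Import ring.
Require Import Defs.

(** Write [S] for the inverse of [flat eta].  Contracting with the Reeb field
    shows that [sharp_pi alpha = S alpha - eta (S alpha) xi], so the anchor of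
    the algebroid is [S] itself.  For [alpha = flat X] and [beta = flat Y] the
    Cartan formulas and [d (d eta) = 0] collapse the bracket of [alpha] and
    [beta] to [flat [X, Y]].  Hence [S] carries the bracket on 1-forms to the Lie
    bracket of vector fields, and every algebroid axiom is transported from the
    tangent bundle.  All identities are checked at a point in a chart; they are
    meaningful near the point because [d eta] and the Lie bracket are natural
    under transition maps, which is the symmetry of second derivatives.
    [flat eta] is invertible since a vector in its kernel is annihilated by
    [eta] and [d eta], hence by the volume form [eta /\ (d eta)^n]. *)

Set Implicit Arguments.
Unset Strict Implicit.
Unset Printing Implicit Defensive.
Import Order.TTheory GRing.Theory Num.Theory.
Import numFieldNormedType.Exports.
Local Open Scope classical_set_scope.
Local Open Scope ring_scope.

(** * Differentials of matrix-valued maps *)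

Section Differentials.
Variable R : realType.

(** The exact shape of the bracket is what makes it collapse. Put X = S alpha, Y = S beta, f =
    eta(X), g = eta(Y). Lie derivatives along X - f xi and Y - g xi produce - f L_xi beta + g L_xi
    alpha, which the L_xi terms of the bracket remove, and - g df + f dg, which cancels against
    L_X(g eta) - L_Y(f eta). The terms - f beta + g alpha remove g i_X d eta - f i_Y d eta. Besides
    - i_[X,Y] d eta there remains (X(g) - Y(f) - d eta(X,Y)) eta = eta([X,Y]) eta, where the last
    summand is the choice lambda = eta. The obstacle is the encoding of sections: the value at p is
    written in the coordinates of [chart_at p], a choice that may jump with p. A section is
    therefore differentiated only through its components in one fixed chart, and each notion defined
    pointwise through [chart_at p] has to be re-expressed near p in that chart before a second
    derivative makes sense. *)

Lemma near_zero_differentiable (V W : normedModType R) (h : V -> W) (x : V) :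
  (\near x, h x = 0) -> differentiable h x.
Proof.
move=> h0.
have H : continuous (0 : V -> W) /\ h \o shift x = cst (h x) + \0 +o_ 0 id.
  split; first exact: cst_continuous.
  apply/eqaddoE; rewrite addr0 (nbhs_singleton h0).
  apply/eqaddoP => _ /posnumP[e].
  have : \forall y \near (0 : V), h (y + x) = 0.
    by move: h0; rewrite (near_shift 0 x); apply: filterS => y /=; rewrite subr0.
  apply: filterS => y /= hy.
  by rewrite !fctE /= hy /cst subr0 normr0 mulr_ge0.
have D0 : 'd h x = \0 :> (V -> W) by apply: diff_unique; case: H.
by apply/diff_locallyP; rewrite D0.
Qed.

(** Two maps that agree near [x] differ by a map vanishing near [x], whose differential is zero.
    This locality is used whenever a formula holds only on a chart domain. *)
Lemma near_eq_differentiable (V W : normedModType R) (f g : V -> W) (x : V) :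
  (\near x, f x = g x) -> differentiable f x -> differentiable g x.
Proof.
move=> fg df; have -> : g = f + (g - f) by rewrite addrC subrK.
apply: differentiableD => //; apply: near_zero_differentiable.
by apply: filterS fg => y /= fgy; rewrite !fctE fgy subrr.
Qed.

Lemma differentiable_mxP (V : normedModType R) (a b : nat)
    (A : V -> 'M[R]_(a, b)) (x : V) :
  differentiable A x <-> forall i j, differentiable (fun y => A y i j) x.
Proof.
split=> [dA i j|dA].
  exact: (differentiable_comp dA (differentiable_coord _ _ _)).
have -> : A = \sum_(i < a) \sum_(j < b) (fun y => A y i j *: delta_mx i j).
  apply/funext => y; rewrite [LHS]matrix_sum_delta fct_sumE.
  by apply: eq_bigr => i _; rewrite fct_sumE.
by do 2! apply: differentiable_sum => ?; exact: differentiableZl.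
Qed.

Lemma derive_mxE (V : normedModType R) (a b : nat) (A : V -> 'M[R]_(a, b)) x v
    i j : differentiable A x ->
  ('D_v A x) i j = 'D_v (fun y => A y i j) x.
Proof. by move=> dA; rewrite derive_mx ?mxE //; exact: diff_derivable. Qed.

Lemma derive_compE (U V W : normedModType R) (f : U -> V) (g : V -> W) x v :
  differentiable f x -> differentiable g (f x) ->
  'D_v (g \o f) x = 'D_('D_v f x) g (f x).
Proof.
move=> df dg; rewrite deriveE; last exact: differentiable_comp.
by rewrite diff_comp //= -deriveE // -deriveE.
Qed.

Lemma deriveDv (V W : normedModType R) (f : V -> W) x u v :
  differentiable f x -> 'D_(u + v) f x = 'D_u f x + 'D_v f x.
Proof. by move=> df; rewrite !deriveE // linearD. Qed.

Lemma deriveBv (V W : normedModType R) (f : V -> W) x u v :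
  differentiable f x -> 'D_(u - v) f x = 'D_u f x - 'D_v f x.
Proof. by move=> df; rewrite !deriveE // linearB. Qed.

Lemma deriveZv (V W : normedModType R) (f : V -> W) x k v :
  differentiable f x -> 'D_(k *: v) f x = k *: 'D_v f x.
Proof. by move=> df; rewrite !deriveE // linearZ. Qed.

Lemma deriveDE (V W : normedModType R) (f g : V -> W) x v :
  differentiable f x -> differentiable g x ->
  'D_v (fun y => f y + g y) x = 'D_v f x + 'D_v g x.
Proof.
by move=> df dg; rewrite -deriveD //; exact: diff_derivable.
Qed.

Lemma deriveBE (V W : normedModType R) (f g : V -> W) x v :
  differentiable f x -> differentiable g x ->
  'D_v (fun y => f y - g y) x = 'D_v f x - 'D_v g x.
Proof.
by move=> df dg; rewrite -deriveB //; exact: diff_derivable.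
Qed.

Lemma differentiable_sumE (V W : normedModType R) n (f : 'I_n -> V -> W) x :
  (forall i, differentiable (f i) x) ->
  differentiable (fun y => \sum_(i < n) f i y) x.
Proof.
move=> df; have -> : (fun y => \sum_(i < n) f i y) = \sum_(i < n) f i.
  by apply/funext => y; rewrite fct_sumE.
exact: differentiable_sum.
Qed.

Lemma derive_sumE (V W : normedModType R) n (f : 'I_n -> V -> W) x v :
  (forall i, differentiable (f i) x) ->
  'D_v (fun y => \sum_(i < n) f i y) x = \sum_(i < n) 'D_v (f i) x.
Proof.
move=> df; have -> : (fun y => \sum_(i < n) f i y) = \sum_(i < n) f i.
  by apply/funext => y; rewrite fct_sumE.
by rewrite derive_sum // => i; exact: diff_derivable.
Qed.

Lemma deriveME (V : normedModType R) (f g : V -> R) x v :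
  differentiable f x -> differentiable g x ->
  'D_v (fun y => f y * g y) x = f x * 'D_v g x + 'D_v f x * g x.
Proof.
move=> df dg; rewrite (_ : (fun y => f y * g y) = f * g) //.
rewrite deriveM; try exact: diff_derivable.
by rewrite /GRing.scale /= [g x * _]mulrC.
Qed.

Lemma differentiable_mulmx (V : normedModType R) (a b c : nat)
    (A : V -> 'M[R]_(a, b)) (B : V -> 'M[R]_(b, c)) x :
  differentiable A x -> differentiable B x ->
  differentiable (fun y => A y *m B y) x.
Proof.
move=> /differentiable_mxP dA /differentiable_mxP dB.
apply/differentiable_mxP => i j.
under eq_fun do rewrite mxE.
by apply: differentiable_sumE => k; apply: differentiableM.
Qed.

Lemma derive_mulmx (V : normedModType R) (a b c : nat)
    (A : V -> 'M[R]_(a, b)) (B : V -> 'M[R]_(b, c)) x v :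
  differentiable A x -> differentiable B x ->
  'D_v (fun y => A y *m B y) x = 'D_v A x *m B x + A x *m 'D_v B x.
Proof.
move=> dA dB; apply/matrixP => i j.
rewrite derive_mxE; last exact: differentiable_mulmx.
have dA' := (differentiable_mxP _ _).1 dA.
have dB' := (differentiable_mxP _ _).1 dB.
under eq_fun do rewrite mxE.
rewrite derive_sumE; last by move=> k; apply: differentiableM.
rewrite !mxE -big_split; apply: eq_bigr => k _ /=.
by rewrite deriveME // !derive_mxE // addrC.
Qed.

Lemma differentiable_trmx (V : normedModType R) (a b : nat)
    (A : V -> 'M[R]_(a, b)) x :
  differentiable A x -> differentiable (fun y => (A y)^T) x.
Proof.
move=> /differentiable_mxP dA; apply/differentiable_mxP => i j.
by under eq_fun do rewrite mxE.
Qed.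

Lemma derive_trmx (V : normedModType R) (a b : nat)
    (A : V -> 'M[R]_(a, b)) x v :
  differentiable A x -> 'D_v (fun y => (A y)^T) x = ('D_v A x)^T.
Proof.
move=> dA; apply/matrixP => i j.
rewrite mxE !derive_mxE //; last exact: differentiable_trmx.
by under eq_fun do rewrite mxE.
Qed.

Lemma differentiable_ev (V : normedModType R) (m : nat)
    (f g : V -> 'rV[R]_m) x :
  differentiable f x -> differentiable g x ->
  differentiable (fun y => ev (f y) (g y)) x.
Proof.
move=> /differentiable_mxP df /differentiable_mxP dg.
by apply: differentiable_sumE => k; apply: differentiableM.
Qed.

Lemma derive_ev (V : normedModType R) (m : nat) (f g : V -> 'rV[R]_m) x v :
  differentiable f x -> differentiable g x ->
  'D_v (fun y => ev (f y) (g y)) x = ev ('D_v f x) (g x) + ev (f x) ('D_v g x).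
Proof.
move=> df dg.
have df' := (differentiable_mxP _ _).1 df.
have dg' := (differentiable_mxP _ _).1 dg.
rewrite /ev derive_sumE; last by move=> k; apply: differentiableM.
rewrite -big_split; apply: eq_bigr => k _ /=.
by rewrite deriveME // !derive_mxE // addrC.
Qed.

End Differentials.

(** * Maps of class C^k *)

Section CkTheory.
Variables (R : realType) (V : normedModType R).
Implicit Types (U : set V) (k : nat).

Lemma Ck_subset (W : normedModType R) k U U' (f : V -> W) :
  U' `<=` U -> Ck k U f -> Ck k U' f.
Proof.
move=> sub; elim: k f => [|k IH] f /=; first by move=> cf x /sub/cf.
by move=> [df Df]; split=> [x /sub/df //|v]; exact/IH/Df.
Qed.

(** A derivative at a point of [U] sees only nearby values, and these stay in [U] because [U] is
    open. In this way junk values outside chart domains never matter. *)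
Lemma Ck_ext (W : normedModType R) k U (f g : V -> W) : open U ->
  (forall x, U x -> f x = g x) -> Ck k U f -> Ck k U g.
Proof.
move=> oU; have nU x : U x -> nbhs x U by move=> Ux; exact: open_nbhs_nbhs.
elim: k f g => [|k IH] f g fg /=.
  move=> cf x Ux; rewrite /prop_for /continuous_at -(fg _ Ux).
  apply: cvg_trans (cf x Ux); apply: near_eq_cvg.
  by apply: filterS (nU x Ux) => y Uy; rewrite (fg y Uy).
move=> [df Df]; split=> [x Ux|v].
  apply: near_eq_differentiable (df x Ux).
  by apply: filterS (nU x Ux) => y Uy; exact: fg.
apply: IH (Df v) => x Ux; apply: near_eq_derive.
by apply: filterS (nU x Ux) => y Uy; exact: fg.
Qed.

Lemma CkW (W : normedModType R) k U (f : V -> W) : Ck k.+1 U f -> Ck k U f.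
Proof.
elim: k f => [|k IH] f /= [df Df].
  by move=> x Ux; exact: differentiable_continuous (df x Ux).
by split=> // v; exact/IH/Df.
Qed.

Lemma Ck_cst (W : normedModType R) k U (a : W) : Ck k U (fun=> a).
Proof.
elim: k a => [|k IH] a /=; first by move=> x _; exact: cst_continuous.
split=> [x _|v]; first exact: differentiable_cst.
have -> : (fun x : V => 'D_v (fun=> a) x) = fun=> 0.
  by apply/funext => x; exact: derive_cst.
exact: IH.
Qed.

Lemma CkD (W : normedModType R) k U (f g : V -> W) : open U ->
  Ck k U f -> Ck k U g -> Ck k U (fun x => f x + g x).
Proof.
move=> oU; elim: k f g => [|k IH] f g /=.
  by move=> cf cg x Ux; apply: cvgD; [exact: (cf x Ux)|exact: (cg x Ux)].
move=> [df Df] [dg Dg]; split=> [x Ux|v].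
  by apply: differentiableD; [exact: df|exact: dg].
apply: Ck_ext (IH _ _ (Df v) (Dg v)) => // x Ux /=.
by rewrite deriveD //; apply: diff_derivable; [exact: df|exact: dg].
Qed.

Lemma Ck_sum (W : normedModType R) k U (I : Type) (r : seq I) (P : pred I)
    (f : I -> V -> W) : open U ->
  (forall i, P i -> Ck k U (f i)) ->
  Ck k U (fun x => \sum_(i <- r | P i) f i x).
Proof.
move=> oU cf; elim: r => [|i r IH].
  by under eq_fun do rewrite big_nil; exact: Ck_cst.
case Pi: (P i); last by under eq_fun do rewrite big_cons Pi.
under eq_fun do rewrite big_cons Pi.
by apply: CkD => //; exact: cf.
Qed.

Lemma CkM k U (f g : V -> R) : open U ->
  Ck k U f -> Ck k U g -> Ck k U (fun x => f x * g x).
Proof.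
move=> oU; elim: k f g => [|k IH] f g.
  by move=> cf cg x Ux; apply: cvgM; [exact: (cf x Ux)|exact: (cg x Ux)].
move=> cf cg; have [df Df] := cf; have [dg Dg] := cg; split=> [x Ux|v].
  by apply: differentiableM; [exact: df|exact: dg].
apply: (Ck_ext oU (f := fun x => f x * 'D_v g x + 'D_v f x * g x)).
  by move=> x Ux; rewrite deriveME //; [exact: df|exact: dg].
by apply: CkD => //; apply: IH => //; exact: CkW || exact: Dg || exact: Df.
Qed.

Lemma CkN k U (f : V -> R) : open U ->
  Ck k U f -> Ck k U (fun x => - f x).
Proof.
by move=> oU cf; under eq_fun do rewrite -mulN1r; apply: CkM => //; exact: Ck_cst.
Qed.

Lemma Ck_prod k U (I : Type) (r : seq I) (P : pred I) (f : I -> V -> R) :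
  open U -> (forall i, P i -> Ck k U (f i)) ->
  Ck k U (fun x => \prod_(i <- r | P i) f i x).
Proof.
move=> oU cf; elim: r => [|i r IH].
  by under eq_fun do rewrite big_nil; exact: Ck_cst.
case Pi: (P i); last by under eq_fun do rewrite big_cons Pi.
under eq_fun do rewrite big_cons Pi.
by apply: CkM => //; exact: cf.
Qed.

Lemma CkV k U (f : V -> R) : open U -> (forall x, U x -> f x != 0) ->
  Ck k U f -> Ck k U (fun x => (f x)^-1).
Proof.
move=> oU f0; elim: k f f0 => [|k IH] f f0.
  by move=> cf x Ux; apply: cvgV; [exact: f0|exact: (cf x Ux)].
move=> cf; have [df Df] := cf; split=> [x Ux|v].
  by apply: differentiableV; [exact: df|exact: f0].
apply: (Ck_ext oU (f := fun x => - ((f x)^-1 * (f x)^-1 * 'D_v f x))).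
  move=> x Ux; rewrite deriveV; [|exact: f0|exact/diff_derivable/df].
  by rewrite /GRing.scale /= mulNr -expr2 exprVn.
apply: CkN => //; apply: CkM => //; last exact: Df.
by apply: CkM => //; apply: IH => //; exact: CkW.
Qed.

Lemma Ck_mxP k U (a b : nat) (A : V -> 'M[R]_(a, b)) : open U ->
  Ck k U A <-> forall i j, Ck k U (fun x => A x i j).
Proof.
move=> oU; split.
  move=> + i j; elim: k A => [|k IH] A.
    move=> cA x Ux.
    exact: (continuous_comp (cA x Ux) (@coord_continuous _ _ _ i j _)).
  move=> [dA DA]; split=> [x Ux|v].
    exact: ((differentiable_mxP A x).1 (dA x Ux) i j).
  apply: Ck_ext (IH _ (DA v)) => // x Ux /=.
  by rewrite derive_mxE //; exact: dA.
elim: k A => [|k IH] A cA.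
  (* The matrix norm is the maximum over finitely many entries, so finitely many neighbourhoods are
     intersected. *)
  move=> x Ux; apply/cvgrPdist_le => /= e e0.
  near=> y.
  rewrite /Num.Def.normr/= mx_normrE (bigmax_le _ (ltW e0))//= => i _.
  rewrite !mxE/=.
  move: i; near: y; apply: filter_forall => /= i.
  exact: ((cvgrPdist_le _ _).1 (cA i.1 i.2 x Ux)).
have dA x : U x -> differentiable A x.
  by move=> Ux; apply/differentiable_mxP => i j; have [H _] := cA i j; exact: H.
split=> // v; apply: IH => i j; have [_ /(_ v)] := cA i j.
by apply: Ck_ext => // x Ux; rewrite derive_mxE //; exact: dA.
Unshelve. all: by end_near. Qed.

Lemma Ck_mxN k U (a b : nat) (A : V -> 'M[R]_(a, b)) : open U ->
  Ck k U A -> Ck k U (fun x => - A x).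
Proof.
move=> oU /(Ck_mxP _ _ oU) cA; apply/(Ck_mxP _ _ oU) => i j.
by under eq_fun do rewrite mxE; exact: CkN.
Qed.

Lemma Ck_mulmx k U (a b c : nat) (A : V -> 'M[R]_(a, b))
    (B : V -> 'M[R]_(b, c)) : open U ->
  Ck k U A -> Ck k U B -> Ck k U (fun x => A x *m B x).
Proof.
move=> oU /(Ck_mxP _ _ oU) cA /(Ck_mxP _ _ oU) cB.
apply/(Ck_mxP _ _ oU) => i j; under eq_fun do rewrite mxE.
by apply: Ck_sum => // l _; exact: CkM.
Qed.

Lemma Ck_trmx k U (a b : nat) (A : V -> 'M[R]_(a, b)) : open U ->
  Ck k U A -> Ck k U (fun x => (A x)^T).
Proof.
move=> oU /(Ck_mxP _ _ oU) cA; apply/(Ck_mxP _ _ oU) => i j.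
by under eq_fun do rewrite mxE.
Qed.

Lemma Ck_ev k U m (f g : V -> 'rV[R]_m) : open U ->
  Ck k U f -> Ck k U g -> Ck k U (fun x => ev (f x) (g x)).
Proof.
move=> oU /(Ck_mxP _ _ oU) cf /(Ck_mxP _ _ oU) cg.
by apply: Ck_sum => // l _; exact: CkM.
Qed.

Lemma Ck_det k U n (A : V -> 'M[R]_n) : open U ->
  Ck k U A -> Ck k U (fun x => \det (A x)).
Proof.
move=> oU /(Ck_mxP _ _ oU) cA; apply: Ck_sum => // s _.
apply: CkM => //; first exact: Ck_cst.
by apply: Ck_prod => // i _; exact: cA.
Qed.

Lemma Ck_invmx k U n (A : V -> 'M[R]_n) : open U ->
  (forall x, U x -> A x \in unitmx) ->
  Ck k U A -> Ck k U (fun x => invmx (A x)).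
Proof.
move=> oU uA cA; apply/(Ck_mxP _ _ oU) => i j.
have cA' := (Ck_mxP _ _ oU).1 cA.
(* Cramer's rule, valid on [U] where the determinant does not vanish. *)
apply: (Ck_ext oU (f := fun x => (\det (A x))^-1 * (\adj (A x)) i j)).
  by move=> x Ux; rewrite /invmx (uA x Ux) [RHS]mxE.
apply: CkM => //.
  by apply: CkV; [|move=> x /uA; rewrite unitmxE unitfE|exact: Ck_det].
under eq_fun do rewrite mxE; apply: CkM => //; first exact: Ck_cst.
apply: Ck_det => //; apply/(Ck_mxP _ _ oU) => i' j'.
by under eq_fun do rewrite !mxE.
Qed.

End CkTheory.

(** * Composition and Jacobians of C^k maps *)

Section CkComposition.
Variables (R : realType) (V : normedModType R) (m : nat).

(** [Ck] differentiates along fixed directions only, while the chain rule yields the direction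
    ['D_v g x], which moves with [x]. Expanding it in the standard basis restores fixed directions,
    so that induction on the order applies to composites. *)
Lemma derive_comp_sum (W : normedModType R) (g : V -> 'rV[R]_m)
    (f : 'rV[R]_m -> W) x v :
  differentiable g x -> differentiable f (g x) ->
  'D_v (f \o g) x
  = \sum_(i < m) ('D_v g x) 0 i *: 'D_(delta_mx 0 i) f (g x).
Proof.
move=> dg df; rewrite derive_compE // deriveE // {1}['D_v g x]row_sum_delta.
by rewrite linear_sum; apply: eq_bigr => i _; rewrite linearZ /= -deriveE.
Qed.

Lemma Ck_comp_real k (U : set V) (U' : set 'rV[R]_m) (g : V -> 'rV[R]_m)
    (f : 'rV[R]_m -> R) : open U -> (forall x, U x -> U' (g x)) ->
  Ck k U g -> Ck k U' f -> Ck k U (f \o g).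
Proof.
move=> oU gU; elim: k f => [|k IH] f.
  move=> cg cf x Ux.
  exact: (continuous_comp (cg x Ux) (cf _ (gU x Ux))).
move=> cg cf; have [dg Dg] := cg; have [df Df] := cf.
split=> [x Ux|v].
  by apply: differentiable_comp; [exact: dg|exact/df/gU].
apply: (Ck_ext oU (f := fun x => \sum_(i < m) ('D_v g x) 0 i *
   ('D_(delta_mx 0 i) f \o g) x)).
  by move=> x Ux; rewrite derive_comp_sum //; [exact: dg|exact/df/gU].
apply: Ck_sum => // i _; apply: CkM => //.
  exact: ((Ck_mxP _ _ oU).1 (Dg v) 0 i).
by apply: IH => //; exact: CkW || exact: Df.
Qed.

Lemma Ck_comp k (U : set V) (U' : set 'rV[R]_m) (a b : nat)
    (g : V -> 'rV[R]_m) (f : 'rV[R]_m -> 'M[R]_(a, b)) :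
  open U -> open U' -> (forall x, U x -> U' (g x)) ->
  Ck k U g -> Ck k U' f -> Ck k U (f \o g).
Proof.
move=> oU oU' gU cg /(Ck_mxP _ _ oU') cf; apply/(Ck_mxP _ _ oU) => i j.
exact: Ck_comp_real (cf i j).
Qed.

Lemma Ck_jacobian k (U : set 'rV[R]_m) b (f : 'rV[R]_m -> 'rV[R]_b) :
  open U -> Ck k.+1 U f -> Ck k U (jacobian f).
Proof.
move=> oU [df Df]; apply/(Ck_mxP _ _ oU) => i j.
apply: (Ck_ext oU (f := fun x => ('D_(delta_mx 0 i) f x) 0 j)).
  by move=> x Ux; rewrite (deriveEjacobian _ (df x Ux)) -rowE mxE.
exact: ((Ck_mxP _ _ oU).1 (Df _) 0 j).
Qed.

End CkComposition.

(** * Symmetry of second derivatives *)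

Section SecondDerivative.
Variables (R : realType) (V : normedModType R).

Lemma is_derive_line (f : V -> R) (x u : V) (s : R) :
  differentiable f (s *: u + x) ->
  is_derive s 1 (fun r : R => f (r *: u + x)) ('D_u f (s *: u + x)).
Proof.
move=> df.
have dl : differentiable (fun r : R => r *: u + x) s.
  by apply: differentiableD => //; exact: differentiable_cst.
apply: DeriveDef; first exact/diff_derivable/differentiable_comp.
rewrite (derive_compE (g := f)) //; congr (derive f _ _).
rewrite (_ : (fun r : R => r *: u + x) = ( *:%R^~ u) + cst x) //.
rewrite deriveD //; try exact: diff_derivable.
by rewrite derive_cst addr0 deriveE // diff_val scale1r.
Qed.

(** The double difference is the increment over [0, t] of [phi], the difference of [f] on two
    parallel segments. The mean value theorem in the direction [u] turns it into an increment of
    ['D_u f] along [v], and a second application finishes. *)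
Lemma second_difference (U : set V) (f : V -> R) (x u v : V) (t : R) :
  Ck 2 U f -> 0 < t ->
  (forall s r, 0 <= s <= t -> 0 <= r <= t -> U (s *: u + (r *: v + x))) ->
  exists s r, [/\ 0 <= s <= t, 0 <= r <= t &
    f (t *: u + (t *: v + x)) - f (t *: u + x) - (f (t *: v + x) - f x)
    = t * t * 'D_v ('D_u f) (s *: u + (r *: v + x))].
Proof.
move=> [df /(_ u)[dDf _]] t0 inU.
have tt : 0 <= t <= t by rewrite lexx ltW.
have zt : 0 <= (0 : R) <= t by rewrite lexx ltW.
have inU0 s : 0 <= s <= t -> U (s *: u + x).
  by move=> st; have := inU s 0 st zt; rewrite scale0r add0r.
pose phi s : R := f (s *: u + (t *: v + x)) - f (s *: u + x).
have dphi (s : R) : 0 <= s <= t -> is_derive s 1 phi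
    ('D_u f (s *: u + (t *: v + x)) - 'D_u f (s *: u + x)).
  move=> st; apply: is_deriveB.
    by apply: is_derive_line; exact/df/inU.
  by apply: is_derive_line; exact/df/inU0.
have [||s sin es] := MVT t0 (f := phi)
    (df := fun s => 'D_u f (s *: u + (t *: v + x)) - 'D_u f (s *: u + x)).
- by move=> s; rewrite in_itv /= => /andP[s0 st]; apply: dphi; rewrite !ltW.
- apply: derivable_within_continuous => s; rewrite in_itv /= => st.
  by have [] := dphi s st.
have st : 0 <= s <= t.
  by move: sin; rewrite in_itv /= => /andP[? ?]; rewrite !ltW.
pose psi r : R := 'D_u f (r *: v + (s *: u + x)).
have swap r : r *: v + (s *: u + x) = s *: u + (r *: v + x) by rewrite addrCA.
have dpsi (r : R) : 0 <= r <= t -> is_derive r 1 psi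
    ('D_v ('D_u f) (r *: v + (s *: u + x))).
  by move=> rt; apply: is_derive_line; rewrite swap; exact/dDf/inU.
have [||r rin er] := MVT t0 (f := psi)
    (df := fun r => 'D_v ('D_u f) (r *: v + (s *: u + x))).
- by move=> r; rewrite in_itv /= => /andP[r0 rt]; apply: dpsi; rewrite !ltW.
- apply: derivable_within_continuous => r; rewrite in_itv /= => rt.
  by have [] := dpsi r rt.
have rt : 0 <= r <= t.
  by move: rin; rewrite in_itv /= => /andP[? ?]; rewrite !ltW.
exists s, r; split => //.
move: es er; rewrite /phi /psi !scale0r !add0r subr0 !swap => -> ->.
by rewrite [in RHS]mulrC mulrA.
Qed.

(** The double difference is symmetric in [u] and [v], so the two mixed derivatives take a common
    value at two points arbitrarily close to [x]; continuity of both at [x] does the rest. *)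
Lemma derive_comm (U : set V) (f : V -> R) (x u v : V) : open U ->
  Ck 2 U f -> U x -> 'D_u ('D_v f) x = 'D_v ('D_u f) x.
Proof.
move=> oU cf Ux.
have [_ Df] := cf; have [_ /(_ v) /= cA] := Df u; have [_ /(_ u) /= cB] := Df v.
have ca := cA _ Ux; have cb := cB _ Ux.
apply/eqP; rewrite -subr_eq0 -normr_le0; apply/ler_addgt0Pr => e e0.
rewrite add0r.
have exch (a b c d : R) : a - b - (c - d) = a - c - (b - d) by ring.
have e2 : 0 < e / 2 by rewrite divr_gt0.
have : \forall y \near x, [/\ U y,
    `|'D_v ('D_u f) x - 'D_v ('D_u f) y| < e / 2 &
    `|'D_u ('D_v f) x - 'D_u ('D_v f) y| < e / 2].
  have nU : nbhs x U by exact: open_nbhs_nbhs.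
  have na : nbhs x [set y | `|'D_v ('D_u f) x - 'D_v ('D_u f) y| < e / 2].
    exact: ((cvgrPdist_lt _ _).1 ca _ e2).
  have nb : nbhs x [set y | `|'D_u ('D_v f) x - 'D_u ('D_v f) y| < e / 2].
    exact: ((cvgrPdist_lt _ _).1 cb _ e2).
  apply: filterS (filterI nU (filterI na nb)) => y [Uy [Ha Hb]].
  split; [exact: Uy|exact: Ha|exact: Hb].
move=> /nbhs_ballP[d /= d0 Hd].
(* Chosen so that t (1 + |u| + |v|) = d / 2, which keeps the whole parallelogram in the ball of
   radius [d]; the summand 1 avoids division by zero. *)
pose t := d / (1 + `|u| + `|v|) / 2.
have n0 : 0 < 1 + `|u| + `|v| by rewrite -addrA ltr_pwDl // addr_ge0.
have t0 : 0 < t by rewrite !divr_gt0.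
have inb s r : 0 <= s <= t -> 0 <= r <= t -> ball x d (s *: u + (r *: v + x)).
  move=> /andP[s0 st] /andP[r0 rt]; rewrite -ball_normE /=.
  rewrite addrA opprD addrCA subrr addr0 normrN.
  apply: le_lt_trans (ler_normD _ _) _.
  rewrite !normrZ (ger0_norm s0) (ger0_norm r0).
  apply: (@le_lt_trans _ _ (t * (1 + `|u| + `|v|))).
    rewrite -addrA !mulrDr ler_wpDl //; first by rewrite mulr1 ltW.
    by rewrite lerD // ler_wpM2r.
  by rewrite /t mulrAC divfK ?gt_eqF // ltr_pdivrMr // ltr_pMr // ltr1n.
have [s [r [st rt E]]] := second_difference (x := x) (u := u) (v := v) cf t0
  (fun s r st rt => let: And3 H _ _ := Hd _ (inb s r st rt) in H).
have inb' s' r' : 0 <= s' <= t -> 0 <= r' <= t ->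
    ball x d (s' *: v + (r' *: u + x)).
  by move=> ? ?; rewrite addrCA; exact: inb.
have [s' [r' [st' rt' E']]] := second_difference (x := x) (u := v) (v := u) cf t0
  (fun s r st rt => let: And3 H _ _ := Hd _ (inb' s r st rt) in H).
have EE : 'D_v ('D_u f) (s *: u + (r *: v + x))
        = 'D_u ('D_v f) (s' *: v + (r' *: u + x)).
  apply: (mulfI (x := t * t)); first by rewrite mulf_neq0 // gt_eqF.
  apply: (etrans (esym E)); apply: (etrans _ E').
  by rewrite [t *: v + (t *: u + x)]addrCA; exact: exch.
have [_ H1 _] := Hd _ (inb s r st rt).
have [_ _ H2] := Hd _ (inb' s' r' st' rt').
(* Triangle inequality through the common value of the two mixed derivatives. *)
rewrite -EE in H2; rewrite -(subrK ('D_v ('D_u f) (s *: u + (r *: v + x)))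
  ('D_u ('D_v f) x)) -addrA [e]splitr.
apply: le_trans (ler_normD _ _) _; apply: lerD; first exact: ltW H2.
rewrite distrC; exact: ltW H1.
Qed.

Lemma derive_comm_mx (U : set V) (a b : nat) (f : V -> 'M[R]_(a, b))
    (x u v : V) : open U ->
  Ck 2 U f -> U x -> 'D_u ('D_v f) x = 'D_v ('D_u f) x.
Proof.
move=> oU cf Ux; have [df Df] := cf.
have [dDu _] := Df u; have [dDv _] := Df v.
apply/matrixP => i j.
apply: (etrans (derive_mxE u i j (dDv x Ux))).
apply: (etrans _ (esym (derive_mxE v i j (dDu x Ux)))).
have near_coord w : \near x, ('D_w f x) i j = 'D_w (fun y => f y i j) x.
  apply: filterS (open_nbhs_nbhs (conj oU Ux)) => y Uy.
  exact: derive_mxE (df y Uy).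
apply: (etrans (near_eq_derive _ (near_coord v))).
apply: (etrans _ (esym (near_eq_derive _ (near_coord u)))).
exact: derive_comm oU ((Ck_mxP _ _ oU).1 cf i j) Ux.
Qed.

End SecondDerivative.

(** * Multilinear forms *)

Section MultilinearForms.
Variables (R : realType) (m : nat).

Definition set_slot (k : nat) (v : 'I_k -> 'rV[R]_m) (j : 'I_k) (u : 'rV[R]_m) :
  'I_k -> 'rV[R]_m := fun i => if i == j then u else v i.

Definition multilinear (k : nat) (w : kform R m k) : Prop :=
  forall v j c u u', w (set_slot v j (c *: u + u'))
    = c * w (set_slot v j u) + w (set_slot v j u').

(** The vanishing of the contraction of [w] with [u], required in every slot because [kform] carries
    no antisymmetry. *)
Definition annihilated (k : nat) (w : kform R m k) (u : 'rV[R]_m) : Prop :=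
  forall v j, v j = u -> w v = 0.

Lemma set_slot_comp (k l : nat) (h : 'I_l -> 'I_k) (v : 'I_k -> 'rV[R]_m) j u i :
  injective h -> h i = j ->
  (fun x => set_slot v j u (h x)) = set_slot (fun x => v (h x)) i u.
Proof.
by move=> hI hj; apply/funext => x; rewrite /set_slot -hj (inj_eq hI).
Qed.

Lemma set_slot_out (k l : nat) (h : 'I_l -> 'I_k) (v : 'I_k -> 'rV[R]_m) j u :
  (forall i, h i != j) -> (fun x => set_slot v j u (h x)) = fun x => v (h x).
Proof. by move=> hj; apply/funext => x; rewrite /set_slot (negPf (hj x)). Qed.

Lemma set_slot_id (k : nat) (v : 'I_k -> 'rV[R]_m) j : set_slot v j (v j) = v.
Proof. by apply/funext => i; rewrite /set_slot; case: eqP => // ->. Qed.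

Section Wedge.
Variables (k l : nat) (a : kform R m k) (b : kform R m l).

Let injl (s : 'S_(k + l)) : injective (fun i => s (lshift l i)).
Proof. by move=> x y /perm_inj/lshift_inj. Qed.

Let injr (s : 'S_(k + l)) : injective (fun i => s (rshift k i)).
Proof. by move=> x y /perm_inj/rshift_inj. Qed.

(** In the summand of a permutation [s], slot [j] is read by exactly one factor: the one whose block
    of positions contains the preimage of [j] under [s]. The other factor does not change. *)
Lemma wedge_multilinear :
  multilinear a -> multilinear b -> multilinear (wedge a b).
Proof.
move=> ma mb v j c u u'; rewrite /wedge.
rewrite [c * _]mulrCA -mulrDr; congr (_ * _).
rewrite mulr_sumr -big_split; apply: eq_bigr => s _ /=.
have sj : s ((s^-1)%g j) = j by rewrite permKV.
case: (splitP ((s^-1)%g j)) => i Ei.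
  have hi : s (lshift l i) = j by rewrite -sj; congr (s _); exact/val_inj.
  have hr i' : s (rshift k i') != j.
    by rewrite -hi (inj_eq perm_inj) eq_rlshift.
  rewrite !(set_slot_comp _ _ (@injl s) hi) !(set_slot_out _ _ hr) ma mulrDr mulrDl.
  by rewrite [c * (_ * _ * _)]mulrA [c * (_ * _)]mulrCA.
have hi : s (rshift k i) = j by rewrite -sj; congr (s _); exact/val_inj.
have hl i' : s (lshift l i') != j.
  by rewrite -hi (inj_eq perm_inj) eq_lrshift.
rewrite !(set_slot_comp _ _ (@injr s) hi) !(set_slot_out _ _ hl) mb mulrDr.
by rewrite [c * (_ * _ * _)]mulrCA.
Qed.

Lemma wedge_annihilated u :
  annihilated a u -> annihilated b u -> annihilated (wedge a b) u.
Proof.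
move=> na nb v j vj; rewrite /wedge big1 ?mulr0 // => s _.
have sj : s ((s^-1)%g j) = j by rewrite permKV.
case: (splitP ((s^-1)%g j)) => i Ei.
  have hi : s (lshift l i) = j by rewrite -sj; congr (s _); exact/val_inj.
  by rewrite (na _ i) ?mulr0 ?mul0r // hi.
have hi : s (rshift k i) = j by rewrite -sj; congr (s _); exact/val_inj.
by rewrite (nb _ i) ?mulr0 // hi.
Qed.

(** Antisymmetry comes from summing over the whole symmetric group: the sum is reindexed by [s * t],
    where permutations compose from left to right. *)
Lemma wedge_perm (t : 'S_(k + l)) v :
  wedge a b (fun i => v (t i)) = (-1) ^+ t * wedge a b v.
Proof.
rewrite /wedge [RHS]mulrCA; congr (_ * _).
rewrite mulr_sumr [RHS](reindex_inj (mulIg t)) /=.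
apply: eq_bigr => s _; rewrite odd_permM.
have -> : (fun i => v ((s * t)%g (lshift l i))) = fun i => v (t (s (lshift l i))).
  by apply/funext => i; rewrite permM.
have -> : (fun i => v ((s * t)%g (rshift k i))) = fun i => v (t (s (rshift k i))).
  by apply/funext => i; rewrite permM.
rewrite !mulrA; congr (_ * _ * _).
by rewrite -signr_addb addbCA addbb addbF.
Qed.

Lemma wedge_eq_slots v i j : i != j -> v i = v j -> wedge a b v = 0.
Proof.
move=> ij vij; have := wedge_perm (tperm i j) v.
have -> : (fun x => v (tperm i j x)) = v.
  by apply/funext => x; case: tpermP => // ->.
rewrite odd_tperm ij expr1 mulN1r => /eqP.
by rewrite -addr_eq0 -mulr2n mulrn_eq0 /= => /eqP.
Qed.

End Wedge.

Lemma multilinear_sum (k : nat) (w : kform R m k) v j (c : 'I_k -> R)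
    (f : 'I_k -> 'rV[R]_m) : multilinear w ->
  w (set_slot v j (\sum_i c i *: f i)) = \sum_i c i * w (set_slot v j (f i)).
Proof.
move=> mw.
have w0 : w (set_slot v j 0) = 0.
  have := mw v j 1 0 0; rewrite scale1r addr0 mul1r => w2.
  by apply: (addrI (w (set_slot v j 0))); rewrite -w2 addr0.
apply: (big_rec2 (fun x y => w (set_slot v j x) = y)) => // i y x _ <-.
by rewrite mw.
Qed.

(** Cramer's rule for a wedge product. When slot [j] receives a combination of all the [v i], each
    term with i different from j repeats a vector and vanishes, so the coordinate [c 0 j] can be
    read off. *)
Lemma wedge_combination (k l : nat) (a : kform R m k) (b : kform R m l)
    v j (c : 'rV[R]_(k + l)) : multilinear a -> multilinear b ->
  wedge a b (set_slot v j (c *m (\matrix_i v i))) = c 0 j * wedge a b v.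
Proof.
move=> ma mb; rewrite mulmx_sum_row.
under eq_bigr do rewrite rowK.
rewrite multilinear_sum; last exact: wedge_multilinear.
rewrite (bigD1 j) //= big1 ?addr0 ?set_slot_id // => i ij.
rewrite (@wedge_eq_slots _ _ a b _ i j) ?mulr0 //.
by rewrite /set_slot eqxx (negPf ij).
Qed.

(* A nonzero top-degree form forces its arguments to be a basis, and writing
   [u] in that basis gives [c j * wedge a b v = 0] for all coordinates [c j]. *)
Lemma wedge_nondegenerate (k l : nat) (a : kform R m k) (b : kform R m l) v u :
  (k + l)%N = m -> multilinear a -> multilinear b ->
  annihilated a u -> annihilated b u -> wedge a b v != 0 -> u = 0.
Proof.
move=> klm ma mb na nb nz.
have free : row_free (\matrix_i v i : 'M[R]_(k + l, m)).
  rewrite -kermx_eq0; apply/eqP/row_matrixP => i; rewrite row0.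
  set c := row i _; have cv : c *m (\matrix_i v i) = 0.
    by apply/sub_kermxP; exact: row_sub.
  apply/rowP => j; rewrite [RHS]mxE; have := wedge_combination v j c ma mb.
  rewrite cv => /esym.
  have -> : wedge a b (set_slot v j 0) = 0.
    have := wedge_combination v j (0 : 'rV_(k + l)) ma mb.
    by rewrite mul0mx mxE mul0r.
  by move/eqP; rewrite mulf_eq0 (negPf nz) orbF => /eqP.
have /submxP[c uc] : (u <= (\matrix_i v i : 'M[R]_(k + l, m)))%MS.
  by apply: submx_full; rewrite /row_full (eqP free) klm.
suff c0 : c = 0 by rewrite uc c0 mul0mx.
apply/rowP => j; rewrite [RHS]mxE; have := wedge_combination v j c ma mb.
rewrite -uc (@wedge_annihilated _ _ a b u na nb _ j); last first.
  by rewrite /set_slot eqxx.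
by move/esym/eqP; rewrite mulf_eq0 (negPf nz) orbF => /eqP.
Qed.

Lemma wedge_pow_multilinear (w : kform R m 2) n :
  multilinear w -> multilinear (@wedge_pow R m w n).
Proof.
move=> mw; elim: n => [|n IH] /=; first by move=> v [].
exact: wedge_multilinear.
Qed.

Lemma wedge_pow_annihilated (w : kform R m 2) n u :
  annihilated w u -> annihilated (@wedge_pow R m w n) u.
Proof.
move=> mw; elim: n => [|n IH] /=; first by move=> v [].
exact: wedge_annihilated.
Qed.

End MultilinearForms.

(** * Exterior derivative and Lie bracket in coordinates *)

Section Pairing.
Variables (R : realType) (m : nat).
Implicit Types (a b u v : 'rV[R]_m) (k : R).

Lemma evE a v : ev a v = (a *m v^T) 0 0.
Proof. by rewrite mxE; apply: eq_bigr => i _; rewrite mxE. Qed.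

Lemma evC a v : ev a v = ev v a.
Proof. by apply: eq_bigr => i _; rewrite mulrC. Qed.

Lemma evDl a b v : ev (a + b) v = ev a v + ev b v.
Proof. by rewrite !evE mulmxDl mxE. Qed.

Lemma evNl a v : ev (- a) v = - ev a v.
Proof. by rewrite !evE mulNmx mxE. Qed.

Lemma evBl a b v : ev (a - b) v = ev a v - ev b v.
Proof. by rewrite evDl evNl. Qed.

Lemma evZl k a v : ev (k *: a) v = k * ev a v.
Proof. by rewrite !evE -scalemxAl mxE. Qed.

Lemma evDr a u v : ev a (u + v) = ev a u + ev a v.
Proof. by rewrite ![ev a _]evC evDl. Qed.

Lemma evNr a v : ev a (- v) = - ev a v.
Proof. by rewrite ![ev a _]evC evNl. Qed.

Lemma evBr a u v : ev a (u - v) = ev a u - ev a v.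
Proof. by rewrite evDr evNr. Qed.

Lemma evZr k a v : ev a (k *: v) = k * ev a v.
Proof. by rewrite ![ev a _]evC evZl. Qed.

Lemma ev0l v : ev 0 v = 0.
Proof. by rewrite evE mul0mx mxE. Qed.

Lemma ev_delta a i : ev a (delta_mx 0 i) = a 0 i.
Proof.
rewrite /ev (bigD1 i) //= mxE !eqxx mulr1 big1 ?addr0 // => j ji.
by rewrite mxE (negPf ji) andbF mulr0.
Qed.

Lemma ev_inj a b : (forall v, ev a v = ev b v) -> a = b.
Proof. by move=> ab; apply/rowP => i; rewrite -!ev_delta. Qed.

(** A matrix [A] stands for the bilinear form (u, v) |-> [ev (u *m A) v] throughout; in this
    convention [a^T *m b] is the tensor product of the covectors [a] and [b]. *)
Lemma ev_outer a b u v : ev (u *m (a^T *m b)) v = ev a u * ev b v.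
Proof.
by rewrite evE mulmxA -[_ *m b *m _]mulmxA mxE big_ord1 -!evE evC.
Qed.

Lemma representE (phi : 'rV[R]_m -> R) a :
  (forall v, phi v = ev a v) -> represent phi = a.
Proof. by move=> H; apply/rowP => i; rewrite mxE H ev_delta. Qed.

Lemma lin1_mxE n (f : 'rV[R]_m -> 'rV[R]_n) (A : 'M[R]_(m, n)) :
  (forall u, f u = u *m A) -> lin1_mx f = A.
Proof. by move=> H; apply/row_matrixP => i; rewrite !rowE -H; apply/rowP => j;
  rewrite -rowE !mxE. Qed.

End Pairing.

Lemma ev_mulmx (R : realType) (n m : nat) (a : 'rV[R]_n) (B : 'M[R]_(n, m)) v :
  ev (a *m B) v = ev a (v *m B^T).
Proof. by rewrite !evE trmx_mul trmxK mulmxA. Qed.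

(** * Calculus on open subsets of the coordinate space *)

Section LocalCalculus.
Variables (R : realType) (m : nat).
Implicit Types (X Y Z eta : 'rV[R]_m -> 'rV[R]_m) (U : set 'rV[R]_m).

Lemma derive_scale (f : 'rV[R]_m -> R) X x v :
  differentiable f x -> differentiable X x ->
  'D_v (fun y => f y *: X y) x = 'D_v f x *: X x + f x *: 'D_v X x.
Proof.
move=> df dX; have df' : differentiable (fun y => (f y)%:M : 'M[R]_1) x.
  apply/differentiable_mxP => i j; rewrite !ord1.
  by under eq_fun do rewrite mxE eqxx mulr1n.
have -> : (fun y => f y *: X y) = fun y => (f y)%:M *m X y.
  by apply/funext => y; rewrite mul_scalar_mx.
rewrite derive_mulmx // mul_scalar_mx; congr (_ + _).
rewrite -mul_scalar_mx; congr (_ *m _); apply/matrixP => i j.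
rewrite derive_mxE // !ord1 mxE eqxx mulr1n.
by under eq_fun do rewrite mxE eqxx mulr1n.
Qed.

Lemma differentiable_scale (f : 'rV[R]_m -> R) X x :
  differentiable f x -> differentiable X x ->
  differentiable (fun y => f y *: X y) x.
Proof.
move=> df /differentiable_mxP dX; apply/differentiable_mxP => i j.
by under eq_fun do rewrite mxE; exact: differentiableM.
Qed.

Lemma near_open U x (P : set 'rV[R]_m) : open U -> U x -> U `<=` P -> nbhs x P.
Proof. by move=> oU Ux UP; apply: filterS (open_nbhs_nbhs (conj oU Ux)). Qed.

(** Both sides are the second derivative of [f] in the directions [u] and [v]. This is the form in
    which symmetry enters naturality, closedness of d eta and the Jacobi identity. *)
Lemma hessian_sym U b (f : 'rV[R]_m -> 'rV[R]_b) x u v : open U -> Ck 2 U f ->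
  U x -> u *m 'D_v (jacobian f) x = v *m 'D_u (jacobian f) x.
Proof.
move=> oU cf Ux.
have [dJ _] : Ck 1 U (jacobian f) by exact: Ck_jacobian.
have H w w' : w *m 'D_w' (jacobian f) x = 'D_w' ('D_w f) x.
  have -> : w *m 'D_w' (jacobian f) x = 'D_w' (fun y => w *m jacobian f y) x.
    rewrite derive_mulmx; [|exact: differentiable_cst|exact: dJ].
    by rewrite derive_cst mul0mx add0r.
  apply: near_eq_derive; apply: near_open oU Ux _ => y Uy.
  by apply/esym/deriveEjacobian; have [df _] := cf; exact: df.
rewrite !H; exact: derive_comm_mx oU cf Ux.
Qed.

(** The matrix of d eta. Since ['D_u eta x = u *m jacobian eta x], the Jacobian is the form (u, v)
    |-> (D_u eta)(v), and its antisymmetrization is d eta. *)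
Definition dmx eta (x : 'rV[R]_m) : 'M[R]_m :=
  jacobian eta x - (jacobian eta x)^T.

Definition flatmx eta (x : 'rV[R]_m) : 'M[R]_m :=
  (eta x)^T *m eta x - dmx eta x.

Definition bra X Y (x : 'rV[R]_m) : 'rV[R]_m := 'D_(X x) Y x - 'D_(Y x) X x.

Lemma ev_dmx_jacobian eta x u v :
  ev (u *m dmx eta x) v
  = ev (u *m jacobian eta x) v - ev (v *m jacobian eta x) u.
Proof.
by rewrite mulmxBr evBl; rewrite [ev (v *m _) u]ev_mulmx [ev v _]evC.
Qed.

Lemma ev_dmx eta x u v : differentiable eta x ->
  ev (u *m dmx eta x) v = ev ('D_u eta x) v - ev ('D_v eta x) u.
Proof. by move=> de; rewrite ev_dmx_jacobian !deriveEjacobian. Qed.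

Lemma ev_dmxC eta x u v : ev (u *m dmx eta x) v = - ev (v *m dmx eta x) u.
Proof. by rewrite !ev_dmx_jacobian opprB. Qed.

Lemma ev_flatmx eta x u v : ev (u *m flatmx eta x) v
  = - ev (u *m dmx eta x) v + ev (eta x) u * ev (eta x) v.
Proof. by rewrite mulmxDr evDl mulmxN evNl ev_outer addrC. Qed.

Lemma braE X Y x : differentiable X x -> differentiable Y x ->
  bra X Y x = X x *m jacobian Y x - Y x *m jacobian X x.
Proof. by move=> dX dY; rewrite /bra !deriveEjacobian. Qed.

(** The algebra behind d(T^* eta) = T^*(d eta): [J] is the Jacobian of T, [E] that of eta, [e] the
    value of eta, and [K], [K'] are the derivatives of [J] along [u], [v]. The second-order terms
    cancel by the symmetry hypothesis. *)
Lemma dmx_natural_algebra (J E K K' : 'M[R]_m) (e u v : 'rV[R]_m) :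
  v *m K = u *m K' ->
  ev (u *m J *m E *m J^T + e *m K^T) v - ev (v *m J *m E *m J^T + e *m K'^T) u
  = ev (u *m (J *m (E - E^T) *m J^T)) v.
Proof.
have flip (A : 'M[R]_m) a w : ev (a *m A^T) w = ev a (w *m A).
  by rewrite ev_mulmx trmxK.
move=> hK; rewrite !evDl !flip hK opprD addrACA subrr addr0.
rewrite !mulmxA flip mulmxBr evBl; congr (_ - _).
by rewrite flip evC.
Qed.

Lemma dmx_natural U (T eta eta' : 'rV[R]_m -> 'rV[R]_m) x : open U ->
  Ck 2 U T -> U x -> differentiable eta (T x) ->
  (forall y, U y -> eta' y = eta (T y) *m (jacobian T y)^T) ->
  dmx eta' x = jacobian T x *m dmx eta (T x) *m (jacobian T x)^T.
Proof.
move=> oU cT Ux de E.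
have [dT _] := cT; have dTx := dT x Ux.
have [dJ _] : Ck 1 U (jacobian T) by exact: Ck_jacobian.
have dJx := dJ x Ux.
have deT : differentiable (eta \o T) x by exact: differentiable_comp.
pose e y := (eta \o T) y *m (jacobian T y)^T.
have ee' : \near x, e x = eta' x.
  by apply: near_open oU Ux _ => y Uy; rewrite E.
have dee : differentiable e x.
  by apply: differentiable_mulmx => //; exact: differentiable_trmx.
have de' : differentiable eta' x by apply: near_eq_differentiable ee' dee.
have D u : 'D_u eta' x = (u *m jacobian T x) *m jacobian eta (T x)
    *m (jacobian T x)^T + eta (T x) *m ('D_u (jacobian T) x)^T.
  apply: (etrans (esym (near_eq_derive _ ee'))).
  rewrite derive_mulmx //; last exact: differentiable_trmx.
  rewrite derive_trmx // derive_compE // (deriveEjacobian _ de).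
  by rewrite (deriveEjacobian _ dTx).
apply/row_matrixP => i; rewrite !rowE; set u := delta_mx 0 i.
apply: ev_inj => v; apply: (etrans (ev_dmx _ _ de')).
apply: (etrans (congr2 (fun a b => ev a v - ev b u) (D u) (D v))).
exact: dmx_natural_algebra (hessian_sym v u oU cT Ux).
Qed.

Lemma flatmx_natural U (T eta eta' : 'rV[R]_m -> 'rV[R]_m) x : open U ->
  Ck 2 U T -> U x -> differentiable eta (T x) ->
  (forall y, U y -> eta' y = eta (T y) *m (jacobian T y)^T) ->
  flatmx eta' x = jacobian T x *m flatmx eta (T x) *m (jacobian T x)^T.
Proof.
move=> oU cT Ux de E; rewrite /flatmx (dmx_natural oU cT Ux de E) (E x Ux).
move: (dmx eta (T x)) (jacobian T x) => D J.
by rewrite mulmxDr mulmxDl mulmxN mulNmx trmx_mul trmxK !mulmxA.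
Qed.

(** Brackets of T-related fields are T-related. Differentiating X(T y) = X'(y) J(y) leaves a
    second-order term in each half of the bracket; the two are equal by symmetry of the Hessian of
    [T]. *)
Lemma bra_natural U (T X Y X' Y' : 'rV[R]_m -> 'rV[R]_m) x : open U ->
  Ck 2 U T -> U x ->
  differentiable X (T x) -> differentiable Y (T x) ->
  differentiable X' x -> differentiable Y' x ->
  (forall y, U y -> X (T y) = X' y *m jacobian T y) ->
  (forall y, U y -> Y (T y) = Y' y *m jacobian T y) ->
  bra X Y (T x) = bra X' Y' x *m jacobian T x.
Proof.
move=> oU cT Ux dX dY dX' dY' EX EY.
have [dT _] := cT; have dTx := dT x Ux.
have [dJ _] : Ck 1 U (jacobian T) by exact: Ck_jacobian.
have dJx := dJ x Ux.
have D (Z Z' : 'rV[R]_m -> 'rV[R]_m) u : differentiable Z (T x) ->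
    differentiable Z' x -> (forall y, U y -> Z (T y) = Z' y *m jacobian T y) ->
    'D_(u *m jacobian T x) Z (T x)
    = 'D_u Z' x *m jacobian T x + Z' x *m 'D_u (jacobian T) x.
  move=> dZ dZ' EZ; apply: (etrans _ (derive_mulmx u dZ' dJx)).
  rewrite -(deriveEjacobian u dTx).
  apply: (etrans (esym (derive_compE u dTx dZ))); apply: near_eq_derive.
  by apply: near_open oU Ux _ => y Uy; exact: EZ.
rewrite /bra (EX x Ux) (EY x Ux) mulmxBl.
apply: (etrans (congr2 (fun a b => a - b) (D _ _ _ dY dY' EY) (D _ _ _ dX dX' EX))).
have cancel (a b c c' : 'rV[R]_m) : c = c' -> (a + c) - (b + c') = a - b.
  by move=> ->; rewrite opprD addrACA subrr addr0.
exact: cancel (hessian_sym _ _ oU cT Ux).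
Qed.

Lemma Ck_bra k U X Y : open U -> Ck k.+1 U X -> Ck k.+1 U Y -> Ck k U (bra X Y).
Proof.
move=> oU cX cY; have [dX _] := cX; have [dY _] := cY.
apply: (Ck_ext oU (f := fun x => X x *m jacobian Y x - Y x *m jacobian X x)).
  by move=> x Ux; rewrite braE //; [exact: dX|exact: dY].
apply: CkD => //; last apply: Ck_mxN => //.
  by apply: Ck_mulmx => //; [exact: CkW|exact: Ck_jacobian].
by apply: Ck_mulmx => //; [exact: CkW|exact: Ck_jacobian].
Qed.

Lemma derive_bra U X Y x u : open U -> Ck 2 U X -> Ck 2 U Y -> U x ->
  'D_u (bra X Y) x
  = u *m jacobian X x *m jacobian Y x + X x *m 'D_u (jacobian Y) x
    - (u *m jacobian Y x *m jacobian X x + Y x *m 'D_u (jacobian X) x).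
Proof.
move=> oU cX cY Ux; have [dX _] := cX; have [dY _] := cY.
have [dJX _] : Ck 1 U (jacobian X) by exact: Ck_jacobian.
have [dJY _] : Ck 1 U (jacobian Y) by exact: Ck_jacobian.
have E : \near x, bra X Y x = X x *m jacobian Y x - Y x *m jacobian X x.
  by apply: near_open oU Ux _ => y Uy; rewrite braE //; [exact: dX|exact: dY].
apply: (etrans (near_eq_derive _ E)).
have dXJ := differentiable_mulmx (dX x Ux) (dJY x Ux).
have dYJ := differentiable_mulmx (dY x Ux) (dJX x Ux).
apply: (etrans (deriveBE u dXJ dYJ)).
congr (_ - _).
  apply: (etrans (derive_mulmx u (dX x Ux) (dJY x Ux))).
  by rewrite (deriveEjacobian u (dX x Ux)).
apply: (etrans (derive_mulmx u (dY x Ux) (dJX x Ux))).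
by rewrite (deriveEjacobian u (dY x Ux)).
Qed.

(** [A], [B], [C] are the Jacobians of the three fields, and [AY] is the derivative of [A] along
    [Y], similarly for the others. After the Hessian identities every term occurs twice with
    opposite signs. *)
Lemma bra_jacobi_algebra (X Y Z : 'rV[R]_m)
    (A B C AY AZ BX BZ CX CY : 'M[R]_m) :
  Z *m AY = Y *m AZ -> Z *m BX = X *m BZ -> Y *m CX = X *m CY ->
  X *m B *m C + Y *m CX - (X *m C *m B + Z *m BX)
    - (Y *m C *m A - Z *m B *m A)
  + (Y *m C *m A + Z *m AY - (Y *m A *m C + X *m CY)
    - (Z *m A *m B - X *m C *m B))
  + (Z *m A *m B + X *m BZ - (Z *m B *m A + Y *m AZ)
    - (X *m B *m C - Y *m A *m C)) = 0.
Proof.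
move=> -> -> ->; apply/rowP => i.
move: (X *m B *m C) (X *m C *m B) (Y *m C *m A) (Y *m A *m C) (Z *m A *m B)
  (Z *m B *m A) (Y *m AZ) (X *m BZ) (X *m CY) => *.
by rewrite !mxE; ring.
Qed.

Lemma bra_jacobi U X Y Z x : open U -> Ck 2 U X -> Ck 2 U Y -> Ck 2 U Z ->
  U x -> bra X (bra Y Z) x + bra Y (bra Z X) x + bra Z (bra X Y) x = 0.
Proof.
move=> oU cX cY cZ Ux.
have [dX _] := cX; have [dY _] := cY; have [dZ _] := cZ.
have E A B C : Ck 2 U A -> Ck 2 U B -> Ck 2 U C -> bra A (bra B C) x =
    A x *m jacobian B x *m jacobian C x + B x *m 'D_(A x) (jacobian C) x
    - (A x *m jacobian C x *m jacobian B x + C x *m 'D_(A x) (jacobian B) x)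
    - (B x *m jacobian C x *m jacobian A x - C x *m jacobian B x *m jacobian A x).
  move=> cA cB cC; rewrite {1}/bra (derive_bra (A x) oU cB cC Ux).
  have [dA _] := cA; have [dB _] := cB; have [dC _] := cC.
  rewrite (deriveEjacobian _ (dA x Ux)) (braE (dB x Ux) (dC x Ux)).
  by rewrite mulmxBl.
apply: (etrans (congr2 +%R (congr2 +%R (E X Y Z cX cY cZ) (E Y Z X cY cZ cX))
  (E Z X Y cZ cX cY))).
exact: bra_jacobi_algebra (hessian_sym _ _ oU cX Ux) (hessian_sym _ _ oU cY Ux)
  (hessian_sym _ _ oU cZ Ux).
Qed.

End LocalCalculus.

(** * The bracket of 1-forms in coordinates *)

Section LocalBracket.
Variables (R : realType) (m : nat).
Implicit Types (X Y Z eta alpha beta : 'rV[R]_m -> 'rV[R]_m) (U : set 'rV[R]_m).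

Definition loc_lie X beta (x : 'rV[R]_m) : 'rV[R]_m :=
  'D_(X x) beta x + beta x *m (jacobian X x)^T.

Lemma differentiable_dmx U eta x : open U -> Ck 2 U eta -> U x ->
  differentiable (dmx eta) x.
Proof.
move=> oU ce Ux; have [dJ _] : Ck 1 U (jacobian eta) by exact: Ck_jacobian.
by apply: differentiableB; [exact: dJ|exact/differentiable_trmx/dJ].
Qed.

Lemma derive_dmx U eta x u : open U -> Ck 2 U eta -> U x ->
  'D_u (dmx eta) x = 'D_u (jacobian eta) x - ('D_u (jacobian eta) x)^T.
Proof.
move=> oU ce Ux; have [dJ _] : Ck 1 U (jacobian eta) by exact: Ck_jacobian.
have dJx := dJ x Ux; have dJt := differentiable_trmx dJx.
by apply: (etrans (deriveBE u dJx dJt)); congr (_ - _); exact: derive_trmx.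
Qed.

Lemma dmx_closed_algebra (K L N : 'M[R]_m) (u v w : 'rV[R]_m) :
  v *m K = u *m L -> w *m K = u *m N -> w *m L = v *m N ->
  ev (v *m (K - K^T)) w = ev (u *m (L - L^T)) w - ev (u *m (N - N^T)) v.
Proof.
have E (A : 'M[R]_m) a b : ev (a *m (A - A^T)) b = ev (a *m A) b - ev (b *m A) a.
  by rewrite mulmxBr evBl [ev (b *m A) a]ev_mulmx [ev b _]evC.
move=> e1 e2 e3; rewrite !E e1 e2 e3; ring.
Qed.

(** This is d(d eta) = 0, solved for one of the three terms of the cyclic sum. *)
Lemma dmx_closed U eta x u v w : open U -> Ck 2 U eta -> U x ->
  ev (v *m 'D_u (dmx eta) x) w
  = ev (u *m 'D_v (dmx eta) x) w - ev (u *m 'D_w (dmx eta) x) v.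
Proof.
move=> oU ce Ux; have H a := derive_dmx a oU ce Ux.
rewrite (H u) (H v) (H w); apply: dmx_closed_algebra;
  exact: (hessian_sym _ _ oU ce Ux).
Qed.

Lemma derive_flatmx U eta x u : open U -> Ck 2 U eta -> U x ->
  'D_u (flatmx eta) x
  = ('D_u eta x)^T *m eta x + (eta x)^T *m 'D_u eta x - 'D_u (dmx eta) x.
Proof.
move=> oU ce Ux; have [de _] := ce; have dex := de x Ux.
have det := differentiable_trmx dex.
apply: (etrans (deriveBE u (differentiable_mulmx det dex)
  (differentiable_dmx oU ce Ux))).
congr (_ - _); apply: (etrans (derive_mulmx u det dex)).
by rewrite (derive_trmx u dex).
Qed.

Lemma differentiable_flatmx U eta x : open U -> Ck 2 U eta -> U x ->
  differentiable (flatmx eta) x.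
Proof.
move=> oU ce Ux; have [de _] := ce; have dex := de x Ux.
apply: differentiableB; last exact: differentiable_dmx oU ce Ux.
by apply: differentiable_mulmx => //; exact: differentiable_trmx.
Qed.

Lemma derive_flat U eta Y beta x u v : open U -> Ck 2 U eta -> U x ->
  differentiable Y x -> (forall y, U y -> beta y = Y y *m flatmx eta y) ->
  ev ('D_u beta x) v
  = - ev ('D_u Y x *m dmx eta x) v - ev (Y x *m 'D_u (dmx eta) x) v
    + (ev ('D_u eta x) (Y x) + ev (eta x) ('D_u Y x)) * ev (eta x) v
    + ev (eta x) (Y x) * ev ('D_u eta x) v.
Proof.
move=> oU ce Ux dY E.
have EE : \near x, beta x = Y x *m flatmx eta x.
  by apply: near_open oU Ux _ => y Uy; exact: E.
have -> : 'D_u beta x = 'D_u Y x *m flatmx eta x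
    + Y x *m (('D_u eta x)^T *m eta x + (eta x)^T *m 'D_u eta x
              - 'D_u (dmx eta) x).
  apply: (etrans (near_eq_derive u EE)).
  apply: (etrans (derive_mulmx u dY (differentiable_flatmx oU ce Ux))).
  by congr (_ + _ *m _); exact: derive_flatmx oU ce Ux.
rewrite evDl (ev_flatmx eta x).
move: ('D_u eta x : 'rV[R]_m) ('D_u Y x : 'rV[R]_m) ('D_u _ x : 'M[R]_m) => a b K.
move: (dmx eta x) (eta x) (Y x) => D e y.
rewrite mulmxBr mulmxDr !(evBl, evDl) !ev_outer; ring.
Qed.

(** The collapse of the bracket evaluated on one vector v, with all quantities made opaque reals so
    that [ring] applies. Here [f] = eta(X), [g] = eta(Y), and [ev] is the number eta(v), hiding the
    pairing. The letters [p] and [q] denote d eta with a derivative of X or Y in one slot, [h] a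
    derivative of d eta itself, and names in [e] pair eta or its derivative with a vector. The
    hypothesis [hX = hY - hv] is closedness of d eta. *)
Lemma bracket_algebra (p1 p2 q1 q2 hX hY hv eXY eXv eYX eYv evX evY f g ev
    eDvX eDvY eDXY eDYX bxi axi bxv axv LX LY Lb La W DXb DYa Df Dg bDvX aDvY
    bv av bx ax dXY dXv dYv : R) :
  LX = DXb - f * bxi + (bDvX - (Df * bx + f * bxv)) ->
  LY = DYa - g * axi + (aDvY - (Dg * ax + g * axv)) ->
  Lb = bxi + bxv -> La = axi + axv ->
  W = - q1 + hv + q2 ->
  DXb = - p1 - hX + (eXY + eDXY) * ev + g * eXv ->
  DYa = - p2 - hY + (eYX + eDYX) * ev + f * eYv ->
  Df = evX + eDvX -> Dg = evY + eDvY ->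
  bDvX = - q1 + g * eDvX -> aDvY = - q2 + f * eDvY ->
  bv = - dYv + g * ev -> av = - dXv + f * ev ->
  dXY = eXY - eYX -> dXv = eXv - evX -> dYv = eYv - evY ->
  hX = hY - hv -> ax = f -> bx = g ->
  LX - LY - W + f * (Lb - bv) - g * (La - av) - dXY * ev
  = - (p1 - p2) + (eDXY - eDYX) * ev.
Proof.
move=> -> -> -> -> -> -> -> -> -> -> -> -> -> -> -> -> -> -> ->; ring.
Qed.

Lemma ev_loc_lie X beta x v : differentiable X x ->
  ev (loc_lie X beta x) v = ev ('D_(X x) beta x) v + ev (beta x) ('D_v X x).
Proof.
move=> dX; rewrite /loc_lie evDl; congr (_ + _).
by rewrite ev_mulmx trmxK (deriveEjacobian v dX).
Qed.

Lemma ev_loc_lie_sub X xi (f : 'rV[R]_m -> R) beta x v :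
  differentiable X x -> differentiable xi x -> differentiable f x ->
  differentiable beta x ->
  ev (loc_lie (fun y => X y - f y *: xi y) beta x) v
  = ev ('D_(X x) beta x) v - f x * ev ('D_(xi x) beta x) v
    + (ev (beta x) ('D_v X x)
       - ('D_v f x * ev (beta x) (xi x) + f x * ev (beta x) ('D_v xi x))).
Proof.
move=> dX dxi df db; have dfxi := differentiable_scale df dxi.
rewrite ev_loc_lie; last exact: differentiableB.
congr (_ + _).
  rewrite (deriveBv _ _ db) (deriveZv _ _ db) evBl evZl.
  by [].
rewrite (deriveBE v dX dfxi) (derive_scale v df dxi).
move: ('D_v X x : 'rV[R]_m) ('D_v xi x : 'rV[R]_m) ('D_v f x : R) => a b k.
by rewrite evBr evDr !evZr.
Qed.

(** Every term is paired with an arbitrary [v] and expanded by the product rule. The covector [dW]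
    is known only through its pairings, which is how the differential of the function d eta(X, Y) =
    pi(alpha, beta) arrives from the manifold. The relations alpha(xi) = eta(X) and beta(xi) =
    eta(Y) are assumed here and supplied by the Reeb algebra. *)
Lemma local_bracket U eta X Y xi alpha beta (dW : 'rV[R]_m) x :
  open U -> Ck 2 U eta -> U x ->
  differentiable X x -> differentiable Y x -> differentiable xi x ->
  (forall y, U y -> alpha y = X y *m flatmx eta y) ->
  (forall y, U y -> beta y = Y y *m flatmx eta y) ->
  ev (alpha x) (xi x) = ev (eta x) (X x) ->
  ev (beta x) (xi x) = ev (eta x) (Y x) ->
  (forall v, ev dW v = 'D_v (fun y => ev (X y *m dmx eta y) (Y y)) x) ->
  loc_lie (fun y => X y - ev (eta y) (X y) *: xi y) beta x
  - loc_lie (fun y => Y y - ev (eta y) (Y y) *: xi y) alpha x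
  - dW
  + ev (eta x) (X x) *: (loc_lie xi beta x - beta x)
  - ev (eta x) (Y x) *: (loc_lie xi alpha x - alpha x)
  - ev (X x *m dmx eta x) (Y x) *: eta x
  = bra X Y x *m flatmx eta x.
Proof.
move=> oU ce Ux dX dY dxi Ea Eb ax bx EW; have [de _] := ce; have dex := de x Ux.
have dF := differentiable_flatmx oU ce Ux.
have da : differentiable alpha x.
  apply: (near_eq_differentiable _ (differentiable_mulmx dX dF)).
  by apply: near_open oU Ux _ => y Uy; rewrite Ea.
have db : differentiable beta x.
  apply: (near_eq_differentiable _ (differentiable_mulmx dY dF)).
  by apply: near_open oU Ux _ => y Uy; rewrite Eb.
apply: ev_inj => v.
have dD := differentiable_dmx oU ce Ux.
have EWv : ev dW v = - ev (Y x *m dmx eta x) ('D_v X x)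
   + ev (X x *m 'D_v (dmx eta) x) (Y x) + ev (X x *m dmx eta x) ('D_v Y x).
  apply: (etrans (EW v)).
  apply: (etrans (derive_ev v (differentiable_mulmx dX dD) dY)).
  apply: (etrans (congr1 (fun a => ev a (Y x) + _) (derive_mulmx v dX dD))).
  by rewrite evDl; congr (_ + _ + _); exact: ev_dmxC.
have EXf := ev_loc_lie_sub v dX dxi (differentiable_ev dex dX) db.
have EYg := ev_loc_lie_sub v dY dxi (differentiable_ev dex dY) da.
have Exb := ev_loc_lie beta v dxi; have Exa := ev_loc_lie alpha v dxi.
have Db := derive_flat (X x) v oU ce Ux dY Eb.
have Da := derive_flat (Y x) v oU ce Ux dX Ea.
have Df := derive_ev v dex dX; have Dg := derive_ev v dex dY.
have cyc : ev (Y x *m 'D_(X x) (dmx eta) x) v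
  = ev (X x *m 'D_(Y x) (dmx eta) x) v - ev (X x *m 'D_v (dmx eta) x) (Y x).
  exact: dmx_closed oU ce Ux.
have Fb w : ev (beta x) w = - ev (Y x *m dmx eta x) w
    + ev (eta x) (Y x) * ev (eta x) w.
  by rewrite (Eb x Ux); exact: ev_flatmx.
have Fa w : ev (alpha x) w = - ev (X x *m dmx eta x) w
    + ev (eta x) (X x) * ev (eta x) w.
  by rewrite (Ea x Ux); exact: ev_flatmx.
have dE a b := ev_dmx a b dex.
have -> : ev (bra X Y x *m flatmx eta x) v
  = - (ev ('D_(X x) Y x *m dmx eta x) v - ev ('D_(Y x) X x *m dmx eta x) v)
    + (ev (eta x) ('D_(X x) Y x) - ev (eta x) ('D_(Y x) X x)) * ev (eta x) v.
  by apply: (etrans (ev_flatmx _ _ _ _)); rewrite /bra mulmxBl evBl evBr.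
have split (a b c d e h : 'rV[R]_m) (k l n : R) :
    ev (a - b - c + k *: (d - e) - l *: (h - alpha x) - n *: eta x) v
    = ev a v - ev b v - ev c v + k * (ev d v - ev e v)
      - l * (ev h v - ev (alpha x) v) - n * ev (eta x) v.
  by rewrite !(evDl, evNl, evZl).
apply: (etrans (split _ _ _ _ _ _ _ _ _)).
exact: (bracket_algebra EXf EYg Exb Exa EWv Db Da Df Dg (Fb ('D_v X x))
  (Fa ('D_v Y x)) (Fb v) (Fa v) (dE (X x) (Y x)) (dE (X x) v) (dE (Y x) v) cyc
  ax bx).
Qed.

End LocalBracket.

(** * Charts and local representatives *)

Section Charts.
Variables (R : realType) (m : nat) (M : manifold R m).
Implicit Types (a b c : chart_ix M) (p q : M) (U : set M).

Definition trans c c' : 'rV[R]_m -> 'rV[R]_m := chart c' \o chart_inv c.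

Definition chart_dom c : set 'rV[R]_m := chart c @` dom c.

Definition overlap c c' : set 'rV[R]_m := chart c @` (dom c `&` dom c').

Lemma chart_image_open c U : open U -> open (chart c @` (dom c `&` U)).
Proof.
move=> oU; rewrite openE => x [p [dp Up] <-].
have Ox : chart_dom c (chart c p) by exists p.
have n1 : nbhs (chart c p) (chart_dom c).
  by apply: open_nbhs_nbhs; split => //; exact: cod_open.
have n2 : nbhs (chart c p) [set y | U (chart_inv c y)].
  have := chart_inv_continuous Ox; apply; rewrite chartK //.
  exact: open_nbhs_nbhs.
rewrite /interior; apply: filterS (filterI n1 n2) => y [[q dq <-]] /=.
by rewrite chartK // => Uq; exists q.
Qed.

Lemma chart_dom_open c : open (chart_dom c).
Proof. exact: cod_open. Qed.

Lemma overlap_open c c' : open (overlap c c').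
Proof. by apply: chart_image_open; exact: dom_open. Qed.

Lemma overlap_chart c c' p : dom c p -> dom c' p -> overlap c c' (chart c p).
Proof. by move=> ? ?; exists p. Qed.

Lemma trans_chart c c' p : dom c p -> trans c c' (chart c p) = chart c' p.
Proof. by move=> dp; rewrite /trans /= chartK. Qed.

Lemma Ck_trans k c c' : Ck k (overlap c c') (trans c c').
Proof. exact: transition_smooth. Qed.

Lemma trans_differentiable c c' x : overlap c c' x ->
  differentiable (trans c c') x.
Proof. by have [d _] := Ck_trans 1 c c'; exact: d. Qed.

(** Smoothness needs checking in a single chart that contains [U]: any other chart differs from it
    by a smooth transition map. *)
Lemma smooth_on_chart a (r s : nat) U (F : M -> 'M[R]_(r, s)) :
  open U -> U `<=` dom a ->
  smooth (chart a @` U) (F \o chart_inv a) -> smooth_on U F.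
Proof.
move=> oU Ua sF c k.
have oc : open (chart c @` (dom c `&` U)) by exact: chart_image_open.
have oa : open (chart a @` U).
  have -> : U = dom a `&` U by rewrite setIidr.
  exact: chart_image_open.
apply: (Ck_ext oc (f := (F \o chart_inv a) \o trans c a)).
  by move=> x [p [dp Up] <-] /=; rewrite trans_chart // !chartK //; exact: Ua.
apply: (Ck_comp oc oa) (sF k).
  by move=> x [p [dp Up] <-]; exists p => //; rewrite trans_chart.
apply: Ck_subset (Ck_trans k c a) => x [p [dp Up] <-].
by exists p => //; split => //; exact: Ua.
Qed.

Local Notation J c c' p := (jacobian (trans c c') (chart c p)).

Lemma jacobian_trans_id c p : dom c p -> J c c p = 1%:M.
Proof.
move=> dp; apply/row_matrixP => i; rewrite !rowE mulmx1.
have ox : overlap c c (chart c p) by exact: overlap_chart.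
rewrite -(deriveEjacobian _ (trans_differentiable ox)).
have E : \forall x \near chart c p, trans c c x = id x.
  apply: near_open (@overlap_open c c) ox _ => x [q [dq _] <-].
  exact: trans_chart.
by apply: (etrans (near_eq_derive _ E)); exact: derive_id.
Qed.

Lemma jacobian_trans_comp a b c p : dom a p -> dom b p -> dom c p ->
  J a b p *m J b c p = J a c p.
Proof.
move=> da db dc; apply/row_matrixP => i; rewrite !rowE mulmxA.
have oab := trans_differentiable (overlap_chart da db).
have obc := trans_differentiable (overlap_chart db dc).
have oac := trans_differentiable (overlap_chart da dc).
apply: (etrans (congr1 (mulmx^~ _) (esym (deriveEjacobian _ oab)))).
apply: (etrans (esym (deriveEjacobian _ obc))).
apply: (etrans _ (deriveEjacobian _ oac)).
rewrite -(trans_chart b da) in obc *.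
apply: (etrans (esym (derive_compE _ oab obc))); apply: near_eq_derive.
have oU : open (chart a @` (dom a `&` (dom b `&` dom c))).
  by apply: chart_image_open; apply: openI; exact: dom_open.
apply: near_open oU _ _; first by exists p.
by move=> x [q [dqa [dqb dqc]] <-] /=; rewrite !trans_chart.
Qed.

Lemma smooth_jacobian_trans a b :
  smooth_on (dom a `&` dom b) (fun p => J a b p).
Proof.
apply: (@smooth_on_chart a); [|by move=> ? []|move=> k].
  by apply: openI; exact: dom_open.
apply: (Ck_ext (@overlap_open a b) (f := jacobian (trans a b))).
  by move=> x [p [dp _] <-] /=; rewrite chartK.
by apply: Ck_jacobian; [exact: overlap_open|exact: Ck_trans].
Qed.

Lemma cotangent_vector_bundle : vector_bundle (T'M M).
Proof.
split.
- exact: dom_open.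
- exact: dom_chart_at.
- move=> a b c k.
  have oU : open (chart c @` (dom c `&` (dom a `&` dom b))).
    by apply: chart_image_open; apply: openI; exact: dom_open.
  apply: (Ck_trmx oU).
  (* The dual cocycle reverses the two charts, so the intersection of their domains has to be
     commuted. *)
  by have := @smooth_jacobian_trans b a c k; rewrite setIC (setIC (dom a)) setIC.
- by move=> a p da; rewrite /= jacobian_trans_id // trmx1.
- by move=> a b c p da db dc; rewrite /= -trmx_mul jacobian_trans_comp.
Qed.

(** The components in a fixed chart [c], to be contrasted with the raw value [X p], which refers to
    [chart_at p] and cannot be differentiated in [p]. *)
Definition vrep c (X : vector_field M) : 'rV[R]_m -> 'rV[R]_m :=
  local_rep (E := TM M) X c \o chart_inv c.

Definition frep c (alpha : one_form M) : 'rV[R]_m -> 'rV[R]_m :=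
  local_rep (E := T'M M) alpha c \o chart_inv c.

Lemma vrep_chart c X p : dom c p ->
  vrep c X (chart c p) = X p *m J (chart_at p) c p.
Proof. by move=> dp; rewrite /vrep /= chartK. Qed.

Lemma frep_chart c alpha p : dom c p ->
  frep c alpha (chart c p) = alpha p *m (J c (chart_at p) p)^T.
Proof. by move=> dp; rewrite /frep /= chartK. Qed.

Lemma vrep_at X p : vrep (chart_at p) X (chart (chart_at p) p) = X p.
Proof.
have dp := dom_chart_at p.
by rewrite (vrep_chart X dp) (jacobian_trans_id dp) mulmx1.
Qed.

Lemma frep_at alpha p : frep (chart_at p) alpha (chart (chart_at p) p) = alpha p.
Proof.
have dp := dom_chart_at p.
by rewrite (frep_chart alpha dp) (jacobian_trans_id dp) trmx1 mulmx1.
Qed.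

Lemma smooth_vrep X c k : smooth_section X -> Ck k (chart_dom c) (vrep c X).
Proof. by move=> sX; have := sX c c k; rewrite setIid. Qed.

Lemma smooth_frep alpha c k :
  smooth_section alpha -> Ck k (chart_dom c) (frep c alpha).
Proof. by move=> sX; have := sX c c k; rewrite setIid. Qed.

Lemma vrep_smooth X : (forall c k, Ck k (chart_dom c) (vrep c X)) ->
  smooth_section X.
Proof.
move=> sX c; apply: (@smooth_on_chart c) => //; first exact: dom_open.
by move=> k; exact: sX.
Qed.

Lemma frep_smooth alpha : (forall c k, Ck k (chart_dom c) (frep c alpha)) ->
  smooth_section alpha.
Proof.
move=> sX c; apply: (@smooth_on_chart c) => //; first exact: dom_open.
by move=> k; exact: sX.
Qed.

Lemma vrep_trans X c c' x : overlap c c' x ->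
  vrep c' X (trans c c' x) = vrep c X x *m jacobian (trans c c') x.
Proof.
move=> [p [dc dc'] <-]; rewrite (trans_chart c' dc) (vrep_chart X dc) (vrep_chart X dc') -mulmxA.
by congr (_ *m _); apply/esym/jacobian_trans_comp => //; exact: dom_chart_at.
Qed.

Lemma frep_trans alpha c c' x : overlap c c' x ->
  frep c alpha x = frep c' alpha (trans c c' x) *m (jacobian (trans c c') x)^T.
Proof.
move=> [p [dc dc'] <-]; rewrite (trans_chart c' dc) (frep_chart alpha dc) (frep_chart alpha dc').
rewrite -mulmxA -trmx_mul; congr (_ *m _^T).
by apply/esym/jacobian_trans_comp => //; exact: dom_chart_at.
Qed.

Lemma ev_reps alpha X c p : dom c p ->
  ev (frep c alpha (chart c p)) (vrep c X (chart c p)) = ev (alpha p) (X p).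
Proof.
move=> dp; have dp' := dom_chart_at p.
rewrite (frep_chart alpha dp) (vrep_chart X dp) ev_mulmx trmxK -mulmxA.
by rewrite (jacobian_trans_comp dp' dp dp') (jacobian_trans_id dp') mulmx1.
Qed.

End Charts.

(** * Tensors of the manifold in charts *)

Section ChartCalculus.
Variables (R : realType) (m : nat) (M : manifold R m).
Implicit Types (c : chart_ix M) (p q : M) (X Y Z : vector_field M).
Implicit Types (alpha beta eta : one_form M).

Lemma at_chart_dom p : chart_dom (chart_at p) (chart (chart_at p) p).
Proof. by exists p => //; exact: dom_chart_at. Qed.

Lemma vrep_differentiable X c x : smooth_section X -> chart_dom c x ->
  differentiable (vrep c X) x.
Proof. by move=> sX; have [d _] := smooth_vrep c 1 sX; exact: d. Qed.

Lemma frep_differentiable alpha c x : smooth_section alpha -> chart_dom c x ->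
  differentiable (frep c alpha) x.
Proof. by move=> sX; have [d _] := smooth_frep c 1 sX; exact: d. Qed.

Lemma extend_at p v : extend p v p = v.
Proof. by rewrite /extend /= (jacobian_trans_id (dom_chart_at p)) mulmx1. Qed.

(** The auxiliary fields have constant components around [p], so their derivatives disappear from d
    eta and from Lie derivatives. They are controlled only on the domain of the chart at [p], hence
    a direct computation in place of a smoothness lemma. *)
Lemma vrep_extend p v x : chart_dom (chart_at p) x ->
  vrep (chart_at p) (extend p v) x = v.
Proof.
move=> [q dq <-]; rewrite (vrep_chart _ dq) /extend /= -mulmxA.
rewrite (jacobian_trans_comp dq (dom_chart_at q) dq).
by rewrite (jacobian_trans_id dq) mulmx1.
Qed.

Lemma derive_vrep_extend p v w :
  'D_w (vrep (chart_at p) (extend p v)) (chart (chart_at p) p) = 0.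
Proof.
have E : \forall x \near chart (chart_at p) p,
    vrep (chart_at p) (extend p v) x = cst v x.
  apply: near_open (@chart_dom_open _ _ _ (chart_at p)) (at_chart_dom p) _.
  by move=> x; exact: vrep_extend.
by apply: (etrans (near_eq_derive _ E)); exact: derive_cst.
Qed.

Lemma eval_form_extend beta p v :
  eval_form beta (extend p v) \o chart_inv (chart_at p)
  = fun y => ev (frep (chart_at p) beta y) v.
Proof. by apply/funext => y; rewrite /frep /= /local_rep /= ev_mulmx trmxK. Qed.

Lemma dir_deriv_eval_extend X beta p v : smooth_section beta ->
  dir_deriv X (eval_form beta (extend p v)) p
  = ev ('D_(X p) (frep (chart_at p) beta) (chart (chart_at p) p)) v.
Proof.
move=> sb; rewrite /dir_deriv eval_form_extend.
have db := frep_differentiable sb (at_chart_dom p).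
apply: (etrans (derive_ev _ db (differentiable_cst _ _))).
by rewrite derive_cst [ev _ 0]evC ev0l addr0.
Qed.

Lemma lie_bracket_at X Y p : lie_bracket X Y p
  = bra (vrep (chart_at p) X) (vrep (chart_at p) Y) (chart (chart_at p) p).
Proof. by rewrite /bra !vrep_at. Qed.

Lemma ext_derivE eta p u v : smooth_section eta -> ext_deriv eta p u v
  = ev (u *m dmx (frep (chart_at p) eta) (chart (chart_at p) p)) v.
Proof.
move=> se; have de := frep_differentiable se (at_chart_dom p).
rewrite (ev_dmx u v de) /ext_deriv /ext_deriv_fields.
rewrite (dir_deriv_eval_extend (extend p u) p v se).
rewrite (dir_deriv_eval_extend (extend p v) p u se) !extend_at.
have L0 : lie_bracket (extend p u) (extend p v) p = 0.
  by rewrite lie_bracket_at /bra !derive_vrep_extend subrr.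
by rewrite /eval_form L0 [ev _ 0]evC ev0l subr0.
Qed.

Lemma flatE eta p : smooth_section eta ->
  flat eta p = flatmx (frep (chart_at p) eta) (chart (chart_at p) p).
Proof.
move=> se; apply: lin1_mxE => u; apply: representE => v.
by rewrite (ext_derivE p u v se) ev_flatmx frep_at.
Qed.

Lemma lie_derivE X beta p : smooth_section X -> smooth_section beta ->
  lie_deriv X beta p
  = loc_lie (vrep (chart_at p) X) (frep (chart_at p) beta) (chart (chart_at p) p).
Proof.
move=> sX sb; have dX := vrep_differentiable sX (at_chart_dom p).
apply: representE => v; rewrite (ev_loc_lie _ v dX) vrep_at frep_at.
rewrite (dir_deriv_eval_extend X p v sb); congr (_ + _).
rewrite /eval_form lie_bracket_at /bra derive_vrep_extend sub0r.
rewrite (vrep_extend v (at_chart_dom p)) evNr; exact: opprK.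
Qed.

(** [lie_bracket] is computed at each point in that point's own chart. Naturality under the
    transition map gives one formula valid on all of [c], which can be differentiated again. *)
Lemma lie_bracket_vrep X Y c x : smooth_section X -> smooth_section Y ->
  chart_dom c x -> vrep c (lie_bracket X Y) x = bra (vrep c X) (vrep c Y) x.
Proof.
move=> sX sY [p dp <-]; rewrite (vrep_chart _ dp) lie_bracket_at.
have dp' := dom_chart_at p; have op := overlap_chart dp' dp.
have [cp cp'] : chart_dom c (chart c p) /\
  chart_dom (chart_at p) (chart (chart_at p) p) by split; exists p.
(* The base point in [c] is written as the transition image of the base point in [chart_at p], the
   form that naturality requires. *)
rewrite -(trans_chart c dp') in cp *.
apply: esym; exact: (bra_natural (@overlap_open _ _ _ (chart_at p) c)
  (Ck_trans 2 _ _) op (vrep_differentiable sX cp) (vrep_differentiable sY cp)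
  (vrep_differentiable sX cp') (vrep_differentiable sY cp')
  (fun y => @vrep_trans _ _ _ X _ _ y) (fun y => @vrep_trans _ _ _ Y _ _ y)).
Qed.

Lemma smooth_lie_bracket X Y : smooth_section X -> smooth_section Y ->
  smooth_section (lie_bracket X Y).
Proof.
move=> sX sY; apply: vrep_smooth => c k.
apply: (Ck_ext (@chart_dom_open _ _ _ c) (f := bra (vrep c X) (vrep c Y))).
  by move=> x cx; exact/esym/lie_bracket_vrep.
by apply: Ck_bra; [exact: chart_dom_open|exact: smooth_vrep|exact: smooth_vrep].
Qed.

Lemma vrepD c (k : R) X Y :
  vrep c (fun q => k *: X q + Y q) = fun x => k *: vrep c X x + vrep c Y x.
Proof.
by apply/funext => x; rewrite /vrep /local_rep /= mulmxDl scalemxAl.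
Qed.

Lemma vrepZ c (phi : M -> R) X :
  vrep c (fun q => phi q *: X q) = fun x => (phi \o chart_inv c) x *: vrep c X x.
Proof. by apply/funext => x; rewrite /vrep /local_rep /= scalemxAl. Qed.

Lemma lie_bracketC X Y p : lie_bracket X Y p = - lie_bracket Y X p.
Proof. by rewrite /lie_bracket opprB. Qed.

Lemma lie_bracket_linearr (k : R) X Y Z p :
  smooth_section Y -> smooth_section Z -> smooth_section X ->
  lie_bracket X (fun q => k *: Y q + Z q) p
  = k *: lie_bracket X Y p + lie_bracket X Z p.
Proof.
move=> sY sZ sX; rewrite !lie_bracket_at vrepD /bra !vrep_at.
set c := chart_at p; set x := chart c p.
have dX := vrep_differentiable sX (at_chart_dom p).
have dY := vrep_differentiable sY (at_chart_dom p).
have dZ := vrep_differentiable sZ (at_chart_dom p).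
have dk : differentiable (fun=> k : R) x by exact: differentiable_cst.
have E : 'D_(X p) (fun x => k *: vrep c Y x + vrep c Z x) x
    = k *: 'D_(X p) (vrep c Y) x + 'D_(X p) (vrep c Z) x.
  apply: (etrans (deriveDE (X p) (differentiable_scale dk dY) dZ)).
  congr (_ + _).
  by apply: (etrans (derive_scale _ dk dY)); rewrite derive_cst scale0r add0r.
have E' : 'D_(k *: Y p + Z p) (vrep c X) x
    = k *: 'D_(Y p) (vrep c X) x + 'D_(Z p) (vrep c X) x.
  apply: (etrans (deriveDv _ _ dX)); congr (_ + _); exact: deriveZv.
apply: (etrans (congr2 (fun a b => a - b) E E')).
have alg (a b d e : 'rV[R]_m) : k *: a + b - (k *: d + e) = k *: (a - d) + (b - e).
  by rewrite scalerBr opprD addrACA.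
exact: alg.
Qed.

Lemma lie_bracket_linearl (k : R) X Y Z p :
  smooth_section Y -> smooth_section Z -> smooth_section X ->
  lie_bracket (fun q => k *: Y q + Z q) X p
  = k *: lie_bracket Y X p + lie_bracket Z X p.
Proof.
move=> sY sZ sX; rewrite lie_bracketC (lie_bracket_linearr k p sY sZ sX).
have alg (a b a' b' : 'rV[R]_m) : a' = - a -> b' = - b ->
    - (k *: a + b) = k *: a' + b'.
  by move=> -> ->; rewrite scalerN opprD.
exact: alg (lie_bracketC _ _ _) (lie_bracketC _ _ _).
Qed.

Lemma lie_bracket_leibniz (phi : M -> R) X Y p :
  smooth_fun phi -> smooth_section X -> smooth_section Y ->
  lie_bracket X (fun q => phi q *: Y q) p
  = phi p *: lie_bracket X Y p + dir_deriv X phi p *: Y p.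
Proof.
move=> sphi sX sY; rewrite !lie_bracket_at vrepZ /bra !vrep_at.
set c := chart_at p; set x := chart c p.
have dX := vrep_differentiable sX (at_chart_dom p).
have dY := vrep_differentiable sY (at_chart_dom p).
have dphi : differentiable (phi \o chart_inv c) x.
  have [d _] := sphi c 1%N; apply: d.
  by exists p => //; split => //; exact: dom_chart_at.
have E := derive_scale (X p) dphi dY; rewrite vrep_at in E.
have phip : (phi \o chart_inv c) x = phi p.
  by rewrite /= chartK //; exact: dom_chart_at.
rewrite phip in E.
have E' : 'D_((phi \o chart_inv c) x *: Y p) (vrep c X) x
    = phi p *: 'D_(Y p) (vrep c X) x.
  by rewrite phip; exact: deriveZv.
apply: (etrans (congr2 (fun a b => a - b) E E')).
have alg (a b d : 'rV[R]_m) (k : R) : a + k *: b - k *: d = k *: (b - d) + a.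
  by rewrite scalerBr -addrA [LHS]addrC.
exact: alg.
Qed.

Lemma lie_bracket_jacobi X Y Z p :
  smooth_section X -> smooth_section Y -> smooth_section Z ->
  lie_bracket X (lie_bracket Y Z) p + lie_bracket Y (lie_bracket Z X) p
  + lie_bracket Z (lie_bracket X Y) p = 0.
Proof.
move=> sX sY sZ; set c := chart_at p; set x := chart c p.
have cx : chart_dom c x by exact: at_chart_dom.
(* The outer bracket differentiates the inner one, so the inner one must be identified on a
   neighbourhood and not only at [x]. *)
have E A B C : smooth_section A -> smooth_section B -> smooth_section C ->
    lie_bracket A (lie_bracket B C) p
    = bra (vrep c A) (bra (vrep c B) (vrep c C)) x.
  move=> sA sB sC; apply: (etrans (lie_bracket_at _ _ _)); rewrite /bra.
  have H : \forall y \near x,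
      vrep c (lie_bracket B C) y = bra (vrep c B) (vrep c C) y.
    apply: near_open (@chart_dom_open _ _ _ c) cx _ => y cy.
    exact: lie_bracket_vrep.
  have Hx := lie_bracket_vrep sB sC cx.
  exact: (congr2 (fun a b => a - b) (near_eq_derive _ H)
    (congr1 (fun w => 'D_w (vrep c A) x) Hx)).
apply: (etrans (congr2 +%R (congr2 +%R (E X Y Z sX sY sZ) (E Y Z X sY sZ sX))
  (E Z X Y sZ sX sY))).
by apply: bra_jacobi (@chart_dom_open _ _ _ c) _ _ _ cx; exact: smooth_vrep.
Qed.

End ChartCalculus.

(** * The Reeb field and the musical isomorphisms *)

Section ReebAlgebra.
Variables (R : realType) (m : nat) (D : 'M[R]_m) (e : 'rV[R]_m).
Hypotheses (odd_m : odd m) (anti_D : D^T = - D).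
Hypothesis unit_F : e^T *m e - D \in unitmx.

Let F := e^T *m e - D.
Let xi := e *m invmx F.

Lemma odd_antisymmetric_det0 : \det D = 0.
Proof.
have : \det D = - \det D.
  rewrite -{1}det_tr anti_D -scaleN1r detZ -signr_odd odd_m expr1.
  by rewrite mulN1r.
by move/eqP; rewrite -addr_eq0 -mulr2n mulrn_eq0 /= => /eqP.
Qed.

Lemma outer_ev (a u : 'rV[R]_m) : u *m (a^T *m a) = ev a u *: a.
Proof. by apply: ev_inj => v; rewrite ev_outer evZl. Qed.

(* An antisymmetric matrix of odd size has a kernel vector [k], and invertibility
   of [F] forces [ev e k != 0]; the Reeb vector is [k] normalized. *)
Lemma reeb : xi *m D = 0 /\ ev e xi = 1.
Proof.
have /det0P[k k0 kD] : \det D == 0 by rewrite odd_antisymmetric_det0.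
have kF : k *m F = ev e k *: e by rewrite mulmxBr kD subr0 outer_ev.
have t0 : ev e k != 0.
  apply: contraNneq k0 => t0; rewrite -(mulmxK unit_F k) -/F kF t0.
  by rewrite scale0r mul0mx.
have -> : xi = (ev e k)^-1 *: k.
  apply: (can_inj (mulmxK unit_F)); rewrite -/F mulmxKV // -scalemxAl kF.
  by rewrite scalerA mulVf // scale1r.
by rewrite -scalemxAl kD scaler0 evZr mulVf.
Qed.

(** Transposition only changes the sign of [D] in [F], and [xi] is in the kernel of [D]; hence [F]
    and its transpose both send [xi] to [e]. *)
Lemma reeb_tr : e *m (invmx F)^T = xi.
Proof.
have [xD ex] := reeb.
have uFt : F^T \in unitmx by rewrite unitmx_tr.
rewrite trmx_inv; apply: (can_inj (mulmxK uFt)); rewrite mulmxKV //.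
rewrite /F linearB /= trmx_mul trmxK anti_D opprK mulmxDr xD addr0 outer_ev.
by rewrite ex scale1r.
Qed.

(** The left side is the matrix of pi. Substituting [D = F^T - e^T *m e], the first term gives the
    inverse of [F], and the second gives [xi^T *m xi] because [e *m (invmx F)^T = xi]. *)
Lemma sharp_pi_algebra :
  invmx F *m D *m (invmx F)^T = invmx F - xi^T *m xi.
Proof.
have ED : D = F^T - e^T *m e.
  by rewrite /F linearB /= trmx_mul trmxK anti_D opprK addrC addKr.
rewrite [in LHS]ED mulmxBr mulmxBl; congr (_ - _).
  by rewrite trmx_inv mulmxK // unitmx_tr.
rewrite -!mulmxA reeb_tr mulmxA; congr (_ *m _).
by rewrite -reeb_tr trmx_mul trmxK.
Qed.

Lemma ev_reeb a : ev a xi = ev e (a *m invmx F).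
Proof. by rewrite -reeb_tr evC ev_mulmx trmxK. Qed.

End ReebAlgebra.

(** * The flat map, its inverse and the anchor in charts *)

Section ContactCharts.
Variables (R : realType) (m : nat) (M : manifold R m) (eta : one_form M).
Hypotheses (odd_m : odd m) (smooth_eta : smooth_section eta).
Hypothesis flat_unit : forall p, flat eta p \in unitmx.
Implicit Types (c : chart_ix M) (p q : M) (X Y : vector_field M).
Implicit Types (alpha beta : one_form M).

Local Notation Fc c := (flatmx (frep c eta)).
Local Notation Dc c := (dmx (frep c eta)).
Local Notation J c c' p := (jacobian (trans c c') (chart c p)).
Local Notation xi := (contact_xi eta).
Local Notation pi := (contact_pi eta).
Local Notation vec alpha := (map_section (E := T'M M) (F := TM M) (sharp eta) alpha).
Local Notation cov X := (map_section (E := TM M) (F := T'M M) (flat eta) X).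

Lemma flat_chart c p : dom c p ->
  flat eta p = J (chart_at p) c p *m Fc c (chart c p) *m (J (chart_at p) c p)^T.
Proof.
move=> dp; have dp' := dom_chart_at p; have op := overlap_chart dp' dp.
have cp : chart_dom c (chart c p) by exists p.
rewrite -(trans_chart c dp') in cp *; rewrite (flatE p smooth_eta).
exact: (flatmx_natural (@overlap_open _ _ _ (chart_at p) c) (Ck_trans 2 _ _) op
  (frep_differentiable smooth_eta cp) (fun y => @frep_trans _ _ _ eta _ _ y)).
Qed.

Lemma ext_deriv_chart c p u v : dom c p -> ext_deriv eta p u v
  = ev (u *m J (chart_at p) c p *m Dc c (chart c p)) (v *m J (chart_at p) c p).
Proof.
move=> dp; have dp' := dom_chart_at p; have op := overlap_chart dp' dp.
have cp : chart_dom c (chart c p) by exists p.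
rewrite (ext_derivE p u v smooth_eta).
rewrite -(trans_chart c dp') in cp *.
have H := dmx_natural (eta' := frep (chart_at p) eta) (@overlap_open _ _ _ (chart_at p) c) (Ck_trans 2 _ _) op
  (frep_differentiable smooth_eta cp) (fun y => @frep_trans _ _ _ eta _ _ y).
apply: (etrans (congr1 (fun A => ev (u *m A) v) H)).
have alg (A B : 'M[R]_m) :
    ev (u *m (A *m B *m A^T)) v = ev (u *m A *m B) (v *m A).
  by rewrite !mulmxA ev_mulmx trmxK.
exact: alg.
Qed.

(** In any chart the matrix of flat is congruent, through the transition Jacobian, to the one in the
    chart at the point, so invertibility carries over. *)
Lemma Fc_unit c x : chart_dom c x -> Fc c x \in unitmx.
Proof.
move=> [p dp <-]; have := flat_unit p; rewrite (flat_chart dp).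
by rewrite !unitmx_mul => /andP[/andP[]].
Qed.

Lemma Ck_dmx k U (f : 'rV[R]_m -> 'rV[R]_m) : open U -> Ck k.+1 U f ->
  Ck k U (dmx f).
Proof.
move=> oU cf; have cJ := Ck_jacobian oU cf.
by apply: CkD => //; apply: Ck_mxN => //; exact: Ck_trmx.
Qed.

Lemma Ck_Fc k c : Ck k (chart_dom c) (Fc c).
Proof.
have oc := @chart_dom_open _ _ _ c.
have ce k' : Ck k' (chart_dom c) (frep c eta) by exact: smooth_frep.
apply: CkD => //; first by apply: Ck_mulmx => //; exact: Ck_trmx.
by apply: Ck_mxN => //; exact: Ck_dmx.
Qed.

Lemma frep_cov X c x : chart_dom c x ->
  frep c (cov X) x = vrep c X x *m Fc c x.
Proof.
move=> [p dp <-]; have dp' := dom_chart_at p.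
rewrite (frep_chart _ dp) (vrep_chart _ dp) /map_section (flat_chart dp).
move: (jacobian_trans_comp dp dp' dp); rewrite (jacobian_trans_id dp).
move: (J (chart_at p) c p) (J c (chart_at p) p) => A B BA.
by rewrite !mulmxA -[_ *m A^T *m B^T]mulmxA -trmx_mul BA trmx1 mulmx1.
Qed.

Lemma cov_vec alpha : cov (vec alpha) = alpha.
Proof. by apply/funext => p; exact: mulmxKV. Qed.

Lemma vec_cov X : vec (cov X) = X.
Proof. by apply/funext => p; exact: mulmxK. Qed.

Lemma frep_vec alpha c x : chart_dom c x ->
  frep c alpha x = vrep c (vec alpha) x *m Fc c x.
Proof. by move=> cx; rewrite -{1}(cov_vec alpha) frep_cov. Qed.

Lemma smooth_cov X : smooth_section X -> smooth_section (cov X).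
Proof.
move=> sX; apply: frep_smooth => c k; have oc := @chart_dom_open _ _ _ c.
apply: (Ck_ext oc (f := fun x => vrep c X x *m Fc c x)).
  by move=> x cx; apply/esym/frep_cov.
by apply: Ck_mulmx => //; [exact: smooth_vrep|exact: Ck_Fc].
Qed.

Lemma smooth_vec alpha : smooth_section alpha -> smooth_section (vec alpha).
Proof.
move=> sa; apply: vrep_smooth => c k; have oc := @chart_dom_open _ _ _ c.
apply: (Ck_ext oc (f := fun x => frep c alpha x *m invmx (Fc c x))).
  by move=> x cx; rewrite (frep_vec _ cx) mulmxK //; exact: Fc_unit.
apply: Ck_mulmx => //; first exact: smooth_frep.
by apply: Ck_invmx => //; [exact: Fc_unit|exact: Ck_Fc].
Qed.

Let D p := Dc (chart_at p) (chart (chart_at p) p).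

Lemma flat_at p : flat eta p = (eta p)^T *m eta p - D p.
Proof. by rewrite (flatE p smooth_eta) /flatmx frep_at. Qed.

Let anti_D p : (D p)^T = - D p.
Proof. by rewrite /D /dmx linearB /= trmxK opprB. Qed.

Let unit_at p : (eta p)^T *m eta p - D p \in unitmx.
Proof. by rewrite -flat_at. Qed.

Lemma sharp_piE p : sharp_pi pi p = sharp eta p - (xi p)^T *m xi p.
Proof.
apply: (etrans _ (etrans (sharp_pi_algebra odd_m (anti_D p) (unit_at p)) _));
  last by rewrite -flat_at.
rewrite -flat_at -/(sharp eta p).
apply: lin1_mxE => a; apply: representE => b.
rewrite /contact_pi (ext_derivE p _ _ smooth_eta) -/(D p).
by rewrite !mulmxA [RHS]ev_mulmx trmxK.
Qed.

Lemma ev_xi alpha p : ev (alpha p) (xi p) = ev (eta p) (vec alpha p).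
Proof.
have := ev_reeb odd_m (anti_D p) (unit_at p) (alpha p).
by rewrite -flat_at.
Qed.

Lemma sharp_pi_xiE p : sharp_pi_xi pi xi p = sharp eta p.
Proof.
apply: lin1_mxE => a.
by rewrite sharp_piE mulmxBr outer_ev evC subrK.
Qed.

Lemma vec_pi alpha :
  map_section (E := T'M M) (F := TM M) (sharp_pi pi) alpha
  = fun q => vec alpha q - ev (eta q) (vec alpha q) *: xi q.
Proof.
apply/funext => q.
by rewrite {1}/map_section sharp_piE mulmxBr outer_ev evC ev_xi.
Qed.

End ContactCharts.

(** * The bracket of 1-forms on the manifold *)

Section ContactBracket.
Variables (R : realType) (m : nat) (M : manifold R m) (eta : one_form M).
Hypotheses (odd_m : odd m) (smooth_eta : smooth_section eta).
Hypothesis flat_unit : forall p, flat eta p \in unitmx.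
Implicit Types (c : chart_ix M) (p q : M) (X Y : vector_field M).
Implicit Types (alpha beta : one_form M).

Local Notation xi := (contact_xi eta).
Local Notation pi := (contact_pi eta).
Local Notation J c c' p := (jacobian (trans c c') (chart c p)).
Local Notation vec alpha := (map_section (E := T'M M) (F := TM M) (sharp eta) alpha).
Local Notation cov X := (map_section (E := TM M) (F := T'M M) (flat eta) X).

Lemma loc_lie_near (X Y beta : 'rV[R]_m -> 'rV[R]_m) x :
  (\near x, X x = Y x) -> differentiable X x ->
  loc_lie X beta x = loc_lie Y beta x.
Proof.
move=> XY dX; have dY := near_eq_differentiable XY dX.
apply: ev_inj => v; apply: (etrans (ev_loc_lie beta v dX)).
apply: (etrans _ (esym (ev_loc_lie beta v dY))).
exact: (congr2 (fun a b => ev ('D_a beta x) v + ev (beta x) b)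
  (nbhs_singleton XY) (near_eq_derive v XY)).
Qed.

Lemma Ck_scale k (U : set 'rV[R]_m) (f : 'rV[R]_m -> R)
    (X : 'rV[R]_m -> 'rV[R]_m) : open U ->
  Ck k U f -> Ck k U X -> Ck k U (fun x => f x *: X x).
Proof.
move=> oU cf cX; apply/(Ck_mxP _ _ oU) => i j.
under eq_fun do rewrite mxE.
exact: CkM oU cf ((Ck_mxP _ _ oU).1 cX i j).
Qed.

Lemma smooth_xi : smooth_section xi.
Proof. exact: (smooth_vec smooth_eta flat_unit smooth_eta). Qed.

Lemma vrep_vec_pi alpha c x : chart_dom c x ->
  vrep c (map_section (E := T'M M) (F := TM M) (sharp_pi pi) alpha) x
  = vrep c (vec alpha) x
    - ev (frep c eta x) (vrep c (vec alpha) x) *: vrep c xi x.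
Proof.
move=> [p dp <-]; rewrite (ev_reps _ _ dp) (vec_pi odd_m smooth_eta flat_unit).
by rewrite !(vrep_chart _ dp) mulmxBl scalemxAl.
Qed.

Lemma smooth_vec_pi alpha : smooth_section alpha ->
  smooth_section (map_section (E := T'M M) (F := TM M) (sharp_pi pi) alpha).
Proof.
move=> sa; have sX := smooth_vec smooth_eta flat_unit sa.
apply: vrep_smooth => c k; have oc := @chart_dom_open _ _ _ c.
have cX := smooth_vrep c k sX.
apply: (Ck_ext oc (f := fun x => vrep c (vec alpha) x
    - ev (frep c eta x) (vrep c (vec alpha) x) *: vrep c xi x)).
  by move=> x cx; apply/esym/vrep_vec_pi.
apply: CkD => //; apply: Ck_mxN => //; apply: Ck_scale => //.
  by apply: Ck_ev => //; exact: smooth_frep.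
exact: smooth_vrep smooth_xi.
Qed.

Lemma eval_pi_chart alpha beta c x : chart_dom c x ->
  (eval_pi pi alpha beta \o chart_inv c) x
  = ev (vrep c (vec alpha) x *m dmx (frep c eta) x) (vrep c (vec beta) x).
Proof.
move=> [p dp <-]; rewrite /= (chartK dp) !(vrep_chart _ dp).
by rewrite /eval_pi /contact_pi (ext_deriv_chart smooth_eta _ _ dp).
Qed.

(** [differential] records derivatives along basis vectors only. Differentiability of a local
    expression [W] of [f] supplies the linearity needed to pair with an arbitrary [v]. *)
Lemma ev_differential (f : M -> R) (W : 'rV[R]_m -> R) p v :
  differentiable W (chart (chart_at p) p) ->
  (\forall x \near chart (chart_at p) p, (f \o chart_inv (chart_at p)) x = W x) ->
  ev (differential f p) v = 'D_v W (chart (chart_at p) p).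
Proof.
move=> dW fW; rewrite [in RHS](row_sum_delta v) deriveE // linear_sum.
apply: eq_bigr => i _; rewrite linearZ /= -deriveE // [RHS]mulrC.
congr (_ * _); rewrite mxE /dir_deriv extend_at.
exact: near_eq_derive fW.
Qed.

Lemma bracketE alpha beta p : smooth_section alpha -> smooth_section beta ->
  bracket_pi_xi pi xi eta alpha beta p
  = cov (lie_bracket (vec alpha) (vec beta)) p.
Proof.
move=> sa sb; have sX := smooth_vec smooth_eta flat_unit sa.
have sY := smooth_vec smooth_eta flat_unit sb.
set c := chart_at p; set x := chart c p.
have oc := @chart_dom_open _ _ _ c.
have cx : chart_dom c x by exact: at_chart_dom.
have ce := smooth_frep c 2 smooth_eta.
have dX := vrep_differentiable sX cx; have dY := vrep_differentiable sY cx.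
have dxi := vrep_differentiable smooth_xi cx.
have ax a : ev (frep c a x) (vrep c xi x) = ev (frep c eta x) (vrep c (vec a) x).
  by rewrite !frep_at !vrep_at; exact: (ev_xi odd_m smooth_eta flat_unit).
(* The function pi(alpha, beta) = d eta(X, Y), written in the fixed chart. *)
pose W y := ev (vrep c (vec alpha) y *m dmx (frep c eta) y) (vrep c (vec beta) y).
have dW v : ev (differential (eval_pi pi alpha beta) p) v = 'D_v W x.
  apply: ev_differential.
    apply: differentiable_ev => //; apply: differentiable_mulmx => //.
    exact: differentiable_dmx oc ce cx.
  by apply: near_open oc cx _ => y cy; exact: eval_pi_chart.
have H := local_bracket oc ce cx dX dY dxi
  (fun y cy => frep_vec smooth_eta flat_unit alpha cy)
  (fun y cy => frep_vec smooth_eta flat_unit beta cy) (ax alpha) (ax beta) dW.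
have L a b : smooth_section a -> smooth_section b ->
    lie_deriv (map_section (E := T'M M) (F := TM M) (sharp_pi pi) a) b p
    = loc_lie (fun y => vrep c (vec a) y
        - ev (frep c eta y) (vrep c (vec a) y) *: vrep c xi y) (frep c b) x.
  move=> sa' sb'; have sZ := smooth_vec_pi sa'.
  apply: (etrans (lie_derivE p sZ sb')); apply: loc_lie_near.
    by apply: near_open oc cx _ => y cy; exact: vrep_vec_pi.
  exact: vrep_differentiable sZ cx.
have Lx b : smooth_section b -> lie_deriv xi b p = loc_lie (vrep c xi) (frep c b) x.
  by move=> sb'; exact: lie_derivE smooth_xi sb'.
have Fp : bra (vrep c (vec alpha)) (vrep c (vec beta)) x *m flatmx (frep c eta) x
    = cov (lie_bracket (vec alpha) (vec beta)) p.
  by rewrite /map_section lie_bracket_at (flatE p smooth_eta).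
apply: (etrans _ (etrans H Fp)).
(* A congruence principle for the shape of the bracket, so that each ingredient can be matched with
   its coordinate expression separately. *)
have comb (a a' b b' d d' e e' f f' g g' h : 'rV[R]_m) (k k' l l' n n' : R)
    (z z' : 'rV[R]_m) :
    a = a' -> b = b' -> k = k' -> d = d' -> e = e' -> l = l' -> f = f' -> g = g' ->
    n = n' -> z = z' ->
    a - b - h + k *: (d - e) - l *: (f - g) - n *: z
    = a' - b' - h + k' *: (d' - e') - l' *: (f' - g') - n' *: z'.
  by do 10! move=> ->.
rewrite /bracket_pi_xi /bracket_pi.
apply: comb.
- exact: (L _ _ sa sb).
- exact: (L _ _ sb sa).
- by rewrite -ax frep_at vrep_at.
- exact: (Lx _ sb).
- by rewrite frep_at.
- by rewrite -ax frep_at vrep_at.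
- exact: (Lx _ sa).
- by rewrite frep_at.
- apply: (etrans _ (eval_pi_chart _ _ cx)); rewrite /= chartK //.
  exact: dom_chart_at.
- by rewrite frep_at.
Qed.

(** With source and target both read in [a], the matrix is the inverse of that of flat; passing to
    [b] in the target multiplies it by one transition Jacobian. Both factors are smooth on the
    overlap. *)
Lemma smooth_sharp : smooth_bundle_map (E := T'M M) (F := TM M) (sharp eta).
Proof.
move=> a b; apply: (@smooth_on_chart _ _ _ a).
- by apply: openI; exact: dom_open.
- by move=> ? [].
move=> k; have oab := @overlap_open _ _ _ a b.
apply: (Ck_ext oab (f := fun x =>
  invmx (flatmx (frep a eta) x) *m jacobian (trans a b) x)).
  move=> x [p [da db] <-]; rewrite /= (chartK da).
  have dp := dom_chart_at p.
  have aF : flatmx (frep a eta) (chart a p) \in unitmx.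
    by apply: (Fc_unit smooth_eta flat_unit); exists p.
  have E := flat_chart smooth_eta da.
  have AB := jacobian_trans_comp dp da db.
  have uA := jacobian_trans_comp dp da dp; rewrite (jacobian_trans_id dp) in uA.
  have uF := flat_unit p.
  rewrite -/(trans (chart_at p) a) -/(trans (chart_at p) b).
  move: AB uA E uF aF; rewrite /sharp.
  move: (J (chart_at p) a p) (J a b p) (J (chart_at p) b p) (J a (chart_at p) p).
  move: (flat eta p) (flatmx _ _) => F G A B C A' <- AA' EF uF uG.
  apply: (can_inj (mulKmx uG)); rewrite mulKVmx // !mulmxA.
  have A'A : A' *m A = 1%:M by exact: mulmx1C.
  have <- : A' *m F = G *m A^T by rewrite EF !mulmxA A'A mul1mx.
  by rewrite -[_ *m F *m _]mulmxA mulmxV // mulmx1 A'A mul1mx.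
have sub : overlap a b `<=` chart_dom a by move=> x [p [da _] <-]; exists p.
apply: Ck_mulmx => //.
  apply: (Ck_subset sub); apply: Ck_invmx.
  - exact: chart_dom_open.
  - by move=> x; exact: Fc_unit.
  - exact: Ck_Fc.
by apply: Ck_jacobian => //; exact: Ck_trans.
Qed.

Lemma smooth_flat : smooth_bundle_map (E := TM M) (F := T'M M) (flat eta).
Proof.
move=> a b; apply: (@smooth_on_chart _ _ _ a).
- by apply: openI; exact: dom_open.
- by move=> ? [].
move=> k; have oab := @overlap_open _ _ _ a b.
apply: (Ck_ext oab (f := fun x =>
  flatmx (frep a eta) x *m (((fun p => J b a p) \o chart_inv a) x)^T)).
  move=> x [p [da db] <-]; rewrite /= (chartK da).
  have dp := dom_chart_at p.
  have E := flat_chart smooth_eta da.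
  have BA := jacobian_trans_comp db dp da.
  have A'A := jacobian_trans_comp da dp da; rewrite (jacobian_trans_id da) in A'A.
  rewrite -/(trans a (chart_at p)) -/(trans b (chart_at p)).
  move: E BA A'A.
  move: (J (chart_at p) a p) (J b a p) (J b (chart_at p) p) (J a (chart_at p) p).
  move: (flat eta p) (flatmx _ _) => F G A B C A' -> <- A'A.
  by rewrite !mulmxA A'A mul1mx -mulmxA -trmx_mul.
have sub : overlap a b `<=` chart_dom a by move=> x [p [da _] <-]; exists p.
apply: Ck_mulmx => //; first by apply: (Ck_subset sub); exact: Ck_Fc.
apply: Ck_trmx => //; have := @smooth_jacobian_trans _ _ M b a a k.
by apply: Ck_subset => x [p [da db] <-]; exists p.
Qed.

End ContactBracket.

(** * Transport of the algebroid structure *)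

Section ContactAlgebroid.
Variables (R : realType) (m : nat) (M : manifold R m) (eta : one_form M).
Hypotheses (odd_m : odd m) (smooth_eta : smooth_section eta).
Hypothesis flat_unit : forall p, flat eta p \in unitmx.

Local Notation A := (pi_xi_algebroid (contact_pi eta) (contact_xi eta) eta).
Local Notation vec alpha := (map_section (E := T'M M) (F := TM M) (sharp eta) alpha).
Local Notation cov X := (map_section (E := TM M) (F := T'M M) (flat eta) X).

Let anchorE : sharp_pi_xi (contact_pi eta) (contact_xi eta) = sharp eta.
Proof.
by apply/funext => p; exact: (sharp_pi_xiE odd_m smooth_eta flat_unit).
Qed.

Let bracket_cov (s t : one_form M) : smooth_section s -> smooth_section t ->
  bracket_pi_xi (contact_pi eta) (contact_xi eta) eta s t
  = cov (lie_bracket (vec s) (vec t)).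
Proof.
by move=> ss st; apply/funext => p;
  exact: (bracketE odd_m smooth_eta flat_unit p ss st).
Qed.

Let smooth_vec' (s : one_form M) : smooth_section s -> smooth_section (vec s).
Proof. exact: smooth_vec. Qed.

Let smooth_bracket (s t : one_form M) : smooth_section s -> smooth_section t ->
  smooth_section (lie_bracket (vec s) (vec t)).
Proof. by move=> ss st; apply: smooth_lie_bracket; exact: smooth_vec'. Qed.

Let smooth_linear (k : R) (s t : one_form M) :
  smooth_section s -> smooth_section t ->
  smooth_section (E := T'M M) (fun q => k *: s q + t q).
Proof.
move=> ss st; apply: frep_smooth => c j; have oc := @chart_dom_open _ _ _ c.
apply: (Ck_ext oc (f := fun x => k *: frep c s x + frep c t x)).
  by move=> x _; rewrite /frep /local_rep /= mulmxDl scalemxAl.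
apply: CkD => //; last exact: smooth_frep.
by apply: Ck_scale => //; [exact: Ck_cst|exact: smooth_frep].
Qed.

Let smooth_scale (phi : M -> R) (s : one_form M) :
  smooth_fun phi -> smooth_section s ->
  smooth_section (E := T'M M) (fun q => phi q *: s q).
Proof.
move=> sphi ss; apply: frep_smooth => c j; have oc := @chart_dom_open _ _ _ c.
apply: (Ck_ext oc (f := fun x => (phi \o chart_inv c) x *: frep c s x)).
  by move=> x _; rewrite /frep /local_rep /= scalemxAl.
apply: Ck_scale => //; last exact: smooth_frep.
by have := sphi c j; rewrite setIT.
Qed.

Let vec_linear (k : R) (s t : one_form M) :
  vec (fun q => k *: s q + t q) = fun q => k *: vec s q + vec t q.
Proof. by apply/funext => q; rewrite /map_section mulmxDl scalemxAl. Qed.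

Let vec_scale (phi : M -> R) (s : one_form M) :
  vec (fun q => phi q *: s q) = fun q => phi q *: vec s q.
Proof. by apply/funext => q; rewrite /map_section scalemxAl. Qed.

Lemma contact_skew_algebroid : skew_algebroid A.
Proof.
split=> /=.
- exact: cotangent_vector_bundle.
- by rewrite anchorE; exact: smooth_sharp.
- move=> s t ss st; rewrite bracket_cov //.
  by apply: smooth_cov => //; exact: smooth_bracket.
- move=> s ss p; rewrite bracket_cov // /map_section /lie_bracket subrr.
  exact: mul0mx.
- move=> k s s' t ss ss' st p.
  have sk := smooth_linear k ss ss'.
  rewrite !bracket_cov // vec_linear {1}/map_section.
  rewrite (lie_bracket_linearl k p (smooth_vec' ss) (smooth_vec' ss')
    (smooth_vec' st)).
  by rewrite mulmxDl scalemxAl.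
- move=> k s t t' ss st st' p.
  have sk := smooth_linear k st st'.
  rewrite !bracket_cov // vec_linear {1}/map_section.
  rewrite (lie_bracket_linearr k p (smooth_vec' st) (smooth_vec' st')
    (smooth_vec' ss)).
  by rewrite mulmxDl scalemxAl.
- move=> phi s t sphi ss st p; have sp := smooth_scale sphi st.
  rewrite anchorE !bracket_cov // vec_scale {1}/map_section.
  rewrite (lie_bracket_leibniz p sphi (smooth_vec' ss) (smooth_vec' st)).
  rewrite mulmxDl -!scalemxAl; congr (_ + _ *: _).
  by rewrite /map_section /sharp mulmxKV.
Qed.

Lemma contact_lie_algebroid : lie_algebroid A.
Proof.
split; first exact: contact_skew_algebroid.
move=> s t u ss st su p /=.
(* In a nested bracket the inner flat meets the outer sharp and cancels, which leaves a nested Lie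
   bracket under a single flat. *)
have E a b c : smooth_section a -> smooth_section b -> smooth_section c ->
    let br := bracket_pi_xi (contact_pi eta) (contact_xi eta) eta in
    br a (br b c) p
    = lie_bracket (vec a) (lie_bracket (vec b) (vec c)) p *m flat eta p.
  move=> sa sb sc /=; rewrite (bracket_cov sb sc).
  have sbc : smooth_section (cov (lie_bracket (vec b) (vec c))).
    by apply: smooth_cov => //; exact: smooth_bracket.
  by rewrite (bracket_cov sa sbc) (vec_cov flat_unit).
apply: (etrans (congr2 +%R (congr2 +%R (E s t u ss st su) (E t u s st su ss))
  (E u s t su ss st))).
rewrite -!mulmxDl -[RHS](mul0mx _ (flat eta p)); congr (_ *m _).
exact: (lie_bracket_jacobi p (smooth_vec' ss) (smooth_vec' st) (smooth_vec' su)).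
Qed.

Lemma contact_isomorphic : algebroid_isomorphic A (tangent_algebroid M).
Proof.
exists (sharp eta), (flat eta); split=> /=.
- by split; [exact: smooth_sharp|exact: smooth_flat].
- by move=> p; exact: mulVmx.
- by move=> p; exact: mulmxV.
- by move=> p; rewrite anchorE mulmx1.
- move=> s t ss st p; rewrite bracket_cov //.
  by rewrite -[LHS]/(vec (cov _) p) (vec_cov flat_unit).
Qed.

End ContactAlgebroid.

(** * Invertibility of flat from the contact condition *)

Section Nondegeneracy.
Variables (R : realType) (m : nat) (M : manifold R m) (eta : one_form M).
Hypothesis smooth_eta : smooth_section eta.

Lemma contact_flat_unit n p (v : 'I_(1 + n * 2) -> 'rV[R]_m) :
  (1 + n * 2)%N = m -> contact_volume eta p v != 0 -> flat eta p \in unitmx.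
Proof.
move=> dim nz; rewrite -row_free_unit -kermx_eq0.
apply/eqP/row_matrixP => i; rewrite row0; set u := row i _.
have uF : u *m flat eta p = 0 by apply/sub_kermxP; exact: row_sub.
rewrite (flatE p smooth_eta) in uF.
set D := dmx (frep (chart_at p) eta) (chart (chart_at p) p).
have extE a b : ext_deriv eta p a b = ev (a *m D) b by exact: ext_derivE.
have F0 w : - ev (u *m D) w + ev (eta p) u * ev (eta p) w = 0.
  by rewrite -[RHS](ev0l w) -uF ev_flatmx frep_at.
have Duu : ev (u *m D) u = 0.
  have := ev_dmxC (frep (chart_at p) eta) (chart (chart_at p) p) u u.
  by move/eqP; rewrite -addr_eq0 -mulr2n mulrn_eq0 => /eqP.
(* Pairing flat(u) = 0 with [u] itself kills the d eta term and leaves eta(u)^2 = 0; after that d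
   eta(u, w) = 0 for every [w]. *)
have eu : ev (eta p) u = 0.
  by have /eqP := F0 u; rewrite Duu oppr0 add0r mulf_eq0 orbb => /eqP.
have Du w : ev (u *m D) w = 0.
  by have /eqP := F0 w; rewrite eu mul0r addr0 oppr_eq0 => /eqP.
have Du' w : ev (w *m D) u = 0.
  by rewrite /D ev_dmxC -/D Du oppr0.
apply: (wedge_nondegenerate dim _ _ _ _ nz).
- by move=> w j c a b; rewrite !ord1 /set_slot eqxx evDr evZr.
- apply: wedge_pow_multilinear => w j c a b; rewrite !extE.
  by case: j => [[|[|j]] Hj] //; rewrite /set_slot /=
    ?(mulmxDl, evDl, evDr, evZr) -?scalemxAl ?evZl.
- by move=> w j; rewrite ord1 => ->.
- apply: wedge_pow_annihilated => w j; rewrite extE.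
  (* The vector [u] may occupy either slot of d eta, which is why both one-sided vanishing
     statements were prepared. *)
  case: j => [[|[|j]] Hj] // wu.
    by rewrite -(_ : Ordinal Hj = ord0) ?wu ?Du //; exact/val_inj.
  by rewrite -(_ : Ordinal Hj = ord_max) ?wu ?Du' //; exact/val_inj.
Qed.

End Nondegeneracy.

Theorem proposition1p3 (R : realType) (n : nat) (hn : (1 <= n)%N)
    (M : manifold R (2 * n).+1) (eta : one_form M)
    (heta : contact_form n eta) :
  let A := pi_xi_algebroid (contact_pi eta) (contact_xi eta) eta in
  lie_algebroid A /\ algebroid_isomorphic A (tangent_algebroid M).
Proof.
(* Odd dimension is what gives the antisymmetric matrix of d eta a kernel, hence the Reeb
   direction. *)
have odd_m : odd (2 * n).+1 by rewrite /= oddM.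
have [smooth_eta nz] := heta.
have unit_flat p : flat eta p \in unitmx.
  have [v /eqP nzv] := nz p.
  by apply: (contact_flat_unit smooth_eta _ nzv); rewrite mulnC.
by split; [exact: contact_lie_algebroid|exact: contact_isomorphic].
Qed.
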